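(* Let $X$ be an infinite-dimensional complex Banach space and $T\in L(X)$. Then $\sigma_e(T)\subseteq\sigma_{ub}(T)$ if and only if $\sigma_{bf}(T)\subseteq\sigma_{ld}(T)$. Furthermore, $\sigma_{ub}(T)=\sigma_e(T)$ if and only if $\sigma_{ld}(T)=\sigma_{bf}(T)$.
   Context: For $S\in L(X)$: $\alpha(S)=\dim\mathcal N(S)$, $\beta(S)=\operatorname{codim}\mathcal R(S)$, ascent $p(S)=\inf\{n:\mathcal N(S^n)=\mathcal N(S^{n+1})\}$ ($\inf\emptyset=\infty$). $S$ is upper semi-Fredholm if $\mathcal R(S)$ is closed and $\alpha(S)<\infty$; Fredholm if moreover $\beta(S)<\infty$; upper semi-Browder if upper semi-Fredholm with $p(S)<\infty$. $S_{[n]}$ is the restriction of $S$ to $\mathcal R(S^n)$; $S$ is B-Fredholm if for some $n$, $\mathcal R(S^n)$ is closed and $S_{[n]}$ is Fredholm. $\sigma_e(T)$, $\sigma_{ub}(T)$, $\sigma_{bf}(T)$: sets of $\lambda$ with $T-\lambda I$ not Fredholm, not upper semi-Browder, not B-Fredholm. $\sigma_{ld}(T)$ (left Drazin spectrum) is the set of $\lambda$ for which it is not the case that $p=p(T-\lambda I)<\infty$ and $\mathcal R((T-\lambda I)^{p+1})$ is closed. *)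

(* Defs.v *)
From HB Require Import structures.
From mathcomp Require Import all_boot all_order all_algebra.
From mathcomp Require Import all_classical all_reals all_analysis.
From mathcomp Require Import complex.
Set Implicit Arguments. Unset Strict Implicit. Unset Printing Implicit Defensive.
Import Order.TTheory GRing.Theory Num.Theory.
Local Open Scope classical_set_scope.
Local Open Scope ring_scope.

(* Convention: complex Banach space = completeNormedModType over R[i], R : realType. *)

Section Defs.
Variable (K : numDomainType) (V : normedModType K).

Definition in_span (s : seq V) (x : V) : Prop :=
  exists c : 'I_(size s) -> K, x = \sum_(i < size s) c i *: s`_i.

Definition fin_dim (A : set V) : Prop :=
  exists s : seq V, forall x, A x -> in_span s x.

Definition kernel (S : V -> V) : set V := [set x | S x = 0].

(* S restricted to the (invariant, closed) subspace M *)
Definition upper_semi_fredholm_on (M : set V) (S : V -> V) : Prop :=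
  closed (S @` M) /\ fin_dim (M `&` kernel S).

Definition fin_codim_on (M : set V) (S : V -> V) : Prop :=
  exists s : seq V, forall x, M x ->
    exists y z, M y /\ in_span s z /\ x = S y + z.

Definition fredholm_on (M : set V) (S : V -> V) : Prop :=
  upper_semi_fredholm_on M S /\ fin_codim_on M S.

Definition upper_semi_fredholm (S : V -> V) := upper_semi_fredholm_on setT S.
Definition fredholm (S : V -> V) := fredholm_on setT S.

Definition finite_ascent (S : V -> V) : Prop :=
  exists n, kernel (iter n S) = kernel (iter n.+1 S).

Definition upper_semi_browder (S : V -> V) : Prop :=
  upper_semi_fredholm S /\ finite_ascent S.

Definition b_fredholm (S : V -> V) : Prop :=
  exists n, closed (range (iter n S)) /\ fredholm_on (range (iter n S)) S.

Definition left_drazin (S : V -> V) : Prop :=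
  exists p, kernel (iter p S) = kernel (iter p.+1 S) /\
    (forall m, (m < p)%N -> kernel (iter m S) <> kernel (iter m.+1 S)) /\
    closed (range (iter p.+1 S)).

Definition shift (T : V -> V) (l : K) : V -> V := fun x => T x - l *: x.

Definition ess_spec (T : V -> V) : set K := [set l | ~ fredholm (shift T l)].
Definition usb_spec (T : V -> V) : set K := [set l | ~ upper_semi_browder (shift T l)].
Definition bf_spec (T : V -> V) : set K := [set l | ~ b_fredholm (shift T l)].
Definition ld_spec (T : V -> V) : set K := [set l | ~ left_drazin (shift T l)].
End Defs.

(* Main.v *)
Require Import Defs.
From HB Require Import structures.
From mathcomp Require Import all_boot all_order all_algebra.
From mathcomp Require Import all_classical all_reals all_analysis.
From mathcomp Require Import complex ring lra.
Import Order.TTheory GRing.Theory Num.Theory.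
Import numFieldNormedType.Exports Normc.
Set Implicit Arguments. Unset Strict Implicit. Unset Printing Implicit Defensive.
Local Open Scope classical_set_scope.
Local Open Scope ring_scope.

(** Write S = T - l. If S is left Drazin invertible with ascent p, then S is bounded
    below on the closed space M = R(S^p), so S - mu is injective with closed range
    for all small mu <> 0, in particular upper semi-Browder. If this makes S - mu
    Fredholm, then (S - mu) M, and by a gap argument also S M, has finite codimension
    in M, so S is B-Fredholm. Conversely an upper semi-Browder S is left Drazin
    invertible, and a B-Fredholm operator with finite-dimensional kernel and closed
    range is Fredholm, because S^n induces a map X / R(S) -> R(S^n) / R(S^(n+1))
    with finite-dimensional kernel.
    For the equalities it remains to see that a B-Fredholm S has finite ascent once
    the Fredholm operators S - mu (mu <> 0 small) do: otherwise S is onto and not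
    injective on the intersection of the ranges R(S^n), and so is S - mu. *)

(** * The real-valued norm *)

(* The norm of a complex normed module takes values in R[i], which is only
   partially ordered; its real part carries the same information. *)
Definition nrm (R : realType) (X : normedModType R[i]) (x : X) : R :=
  complex.Re `|x|.

Section Norm.
Variables (R : realType) (X : normedModType R[i]).
Implicit Types (x y z : X) (a c : R[i]).

Lemma nrmE x : `|x| = (nrm x)%:C%C.
Proof. by rewrite /nrm RRe_real // ger0_real. Qed.

Lemma nrm_ge0 x : 0 <= nrm x.
Proof. by rewrite -lecR -nrmE normr_ge0. Qed.

Lemma nrm0 : nrm (0 : X) = 0.
Proof. by rewrite /nrm normr0. Qed.

Lemma nrm_eq0 x : nrm x = 0 -> x = 0.
Proof. by move=> x0; apply/eqP; rewrite -normr_eq0 nrmE x0. Qed.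

Lemma nrm_gt0 x : x <> 0 -> 0 < nrm x.
Proof.
by move=> x0; rewrite lt_neqAle nrm_ge0 andbT eq_sym; apply/eqP => /nrm_eq0.
Qed.

Lemma nrmN x : nrm (- x) = nrm x.
Proof. by rewrite /nrm normrN. Qed.

Lemma nrmBC x y : nrm (x - y) = nrm (y - x).
Proof. by rewrite -nrmN opprB. Qed.

Lemma nrmD x y : nrm (x + y) <= nrm x + nrm y.
Proof. by rewrite -lecR rmorphD /= -!nrmE ler_normD. Qed.

Lemma nrmB x y : nrm (x - y) <= nrm x + nrm y.
Proof. by rewrite -(nrmN y) nrmD. Qed.

Lemma nrm_triangle y x z : nrm (x - z) <= nrm (x - y) + nrm (y - z).
Proof. by apply: le_trans (nrmD _ _); rewrite addrA subrK. Qed.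

Lemma nrmZ a x : nrm (a *: x) = normc a * nrm x.
Proof.
apply: complexI; rewrite -nrmE normrZ nrmE rmorphM /=; congr (_ * _).
Qed.

Lemma normcC (r : R) : normc (r%:C%C : R[i]) = `|r|.
Proof. by rewrite /= expr0n addr0 sqrtr_sqr. Qed.

Lemma nbhs_nrm x (U : set X) :
  nbhs x U <-> exists2 e : R, 0 < e & forall y, nrm (x - y) < e -> U y.
Proof.
rewrite -nbhs_ballE; split.
- case=> e /= e0 eU.
  have eR : e = (complex.Re e)%:C%C by rewrite RRe_real // gtr0_real.
  exists (complex.Re e); first by rewrite -ltcR -eR.
  by move=> y xy; apply: eU; rewrite -ball_normE /= eR nrmE ltcR.
- case=> e e0 eU; exists (e%:C%C); first by rewrite /= ltcR.
  by move=> y; rewrite -ball_normE /= nrmE ltcR => /eU.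
Qed.

Lemma closed_nrmP (A : set X) : closed A <->
  forall x, (forall e : R, 0 < e -> exists2 a, A a & nrm (x - a) < e) -> A x.
Proof.
split=> [cA x xA | cA x clx].
- apply: cA => U /nbhs_nrm[e e0 eU].
  by have [a Aa xa] := xA _ e0; exists a; split => //; apply: eU.
- apply: cA => e e0; have /clx[a [Aa xa]] : nbhs x [set y | nrm (x - y) < e].
    by apply/nbhs_nrm; exists e.
  by exists a.
Qed.

End Norm.

Definition nrm_cvg (R : realType) (X : normedModType R[i]) (u : nat -> X) l :=
  forall e : R, 0 < e -> exists n, forall m, (n <= m)%N -> nrm (u m - l) < e.

Lemma nrm_complete (R : realType) (X : completeNormedModType R[i])
    (u : nat -> X) :
  (forall e : R, 0 < e -> exists n, forall m, (n <= m)%N ->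
     nrm (u n - u m) < e) ->
  exists l, nrm_cvg u l.
Proof.
move=> cu.
have : cvg (u @ \oo).
  apply/cauchy_cvgP; apply: cauchy_exP => e e0.
  have eR : e = (complex.Re e)%:C%C by rewrite RRe_real // gtr0_real.
  have [n nu] := cu (complex.Re e) ltac:(by rewrite -ltcR -eR).
  exists (u n); exists n => // m /= nm.
  by rewrite -ball_normE /= eR nrmE ltcR nu.
case/cvg_ex => l ul; exists l => e e0.
have /ul[n _ nu] : nbhs l [set y | nrm (l - y) < e].
  by apply/nbhs_nrm; exists e.
by exists n => m nm; rewrite nrmBC; apply: nu.
Qed.

(** * Bounded operators, limits and linear subspaces *)

Section Bounded.
Variables (R : realType) (X : normedModType R[i]).

Definition blin (S : X -> X) :=
  (forall a x y, S (a *: x + y) = a *: S x + S y) /\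
  exists2 C : R, 0 <= C & forall x, nrm (S x) <= C * nrm x.

Lemma blin_continuous_linear (T : {linear X -> X}) : continuous T -> blin T.
Proof.
move=> cT; split; first by move=> a x y; rewrite linearP.
have /nbhs_nrm[e e0 eT] : nbhs (0 : X) [set y | nrm (T y) < 1].
  apply: (cT 0 [set y | nrm y < 1]); apply/nbhs_nrm; exists 1 => // y.
  by rewrite linear0 sub0r nrmN.
exists (2 / e) => [|x]; first by rewrite divr_ge0 // ltW.
have [->|x0] := EM (x = 0); first by rewrite linear0 !nrm0 mulr0.
have nx := nrm_gt0 x0.
(* Scaling by [t] gives [x] the norm [e / 2], inside the ball where [T] has norm below 1. *)
pose t : R := e / (2 * nrm x).
have t0 : 0 < t by rewrite divr_gt0 // mulr_gt0.
have := eT (t%:C%C *: x).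
rewrite sub0r nrmN /= linearZ !nrmZ normcC gtr0_norm //= => /(_ _).
have -> : t * nrm x = e / 2 by rewrite /t; field; lra.
move=> /(_ ltac:(lra)) h.
have h2 : (2 / e) * nrm x = t^-1 by rewrite /t; field; lra.
by rewrite h2 -div1r ler_pdivlMr // mulrC ltW.
Qed.

Variable S : X -> X.
Hypothesis bS : blin S.

Lemma blinD x y : S (x + y) = S x + S y.
Proof. by have := bS.1 1 x y; rewrite !scale1r. Qed.

Lemma blin0 : S 0 = 0.
Proof. by apply: (addIr (S 0)); rewrite -blinD !add0r. Qed.

Lemma blinZ a x : S (a *: x) = a *: S x.
Proof. by have := bS.1 a x 0; rewrite blin0 !addr0. Qed.

Lemma blinN x : S (- x) = - S x.
Proof. by rewrite -scaleN1r blinZ scaleN1r. Qed.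

Lemma blinB x y : S (x - y) = S x - S y.
Proof. by rewrite blinD blinN. Qed.

Lemma blin_iter n : blin (iter n S).
Proof.
elim: n => [|n [linn [C C0 bn]]]; first by split => //; exists 1 => // x; rewrite mul1r.
split; first by move=> a x y; rewrite /= linn blinD blinZ.
case: bS.2 => D D0 bD; exists (D * C); first exact: mulr_ge0.
by move=> x; rewrite /= -mulrA (le_trans (bD _)) // ler_wpM2l.
Qed.

Lemma blin_shift mu : blin (Defs.shift S mu).
Proof.
split; first by move=> a x y; rewrite /Defs.shift blinD blinZ scalerDr scalerA mulrC -scalerA scalerBr opprD addrACA.
case: bS.2 => D D0 bD; exists (D + normc mu).
  by rewrite addr_ge0 //; case: mu => u v; rewrite sqrtr_ge0.
by move=> x; rewrite /Defs.shift (le_trans (nrmB _ _)) // mulrDl lerD // nrmZ.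
Qed.

Lemma blin_cvg u l : nrm_cvg u l -> nrm_cvg (S \o u) (S l).
Proof.
move=> ul e e0; case: bS.2 => D D0 bD.
have [|n nu] := ul (e / (D + 1)); first by rewrite divr_gt0 //; lra.
exists n => m /nu um; rewrite /= -blinB (le_lt_trans (bD _)) //.
have := nrm_ge0 (u m - l); move: um; rewrite ltr_pdivlMr; last lra.
nra.
Qed.

End Bounded.

Section Limits.
Variables (R : realType) (X : normedModType R[i]).
Implicit Types (u v : nat -> X).

Lemma nrm_small (x : X) : (forall e : R, 0 < e -> nrm x <= e) -> x = 0.
Proof.
move=> h; apply: contrapT => /nrm_gt0 x0.
by have := h (nrm x / 2) ltac:(lra); lra.
Qed.

Lemma nrm_cvg_closed (A : set X) u l :
  closed A -> (forall n, A (u n)) -> nrm_cvg u l -> A l.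
Proof.
move=> /closed_nrmP cA Au ul; apply: cA => e /ul[n nu].
by exists (u n) => //; rewrite nrmBC nu.
Qed.

Lemma nrm_cvg_le u l (B : R) : nrm_cvg u l -> (forall n, nrm (u n) <= B) ->
  nrm l <= B.
Proof.
move=> ul uB; rewrite leNgt; apply/negP => Bl.
have [n /(_ n (leqnn n)) nu] := ul (nrm l - B) ltac:(lra).
have := nrmB (u n) (u n - l); rewrite opprB addrCA subrr addr0.
have := uB n; lra.
Qed.

Lemma nrm_cvgD u v l m :
  nrm_cvg u l -> nrm_cvg v m -> nrm_cvg (fun n => u n + v n) (l + m).
Proof.
move=> ul vm e e0.
have [n1 h1] := ul (e / 2) ltac:(lra); have [n2 h2] := vm (e / 2) ltac:(lra).
exists (maxn n1 n2) => k; rewrite geq_max => /andP[/h1 a /h2 b].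
rewrite opprD addrACA; apply: le_lt_trans (nrmD _ _) _; lra.
Qed.

Lemma nrm_cvg_unique u l m : nrm_cvg u l -> nrm_cvg u m -> l = m.
Proof.
move=> ul um; apply/eqP; rewrite -subr_eq0; apply/eqP; apply: nrm_small => e e0.
have [n1 h1] := ul (e / 2) ltac:(lra); have [n2 h2] := um (e / 2) ltac:(lra).
have a := h1 _ (leq_maxl n1 n2); have b := h2 _ (leq_maxr n1 n2).
have := nrm_triangle (u (maxn n1 n2)) l m; rewrite (nrmBC l (u _)); lra.
Qed.

End Limits.

Definition lsubspace (R : realType) (X : normedModType R[i]) (A : set X) :=
  A 0 /\ forall a x y, A x -> A y -> A (a *: x + y).

Section Subspace.
Variables (R : realType) (X : normedModType R[i]) (A : set X).
Hypothesis sA : lsubspace A.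

Lemma subspD x y : A x -> A y -> A (x + y).
Proof. by move=> Ax Ay; have := sA.2 1 x y Ax Ay; rewrite scale1r. Qed.

Lemma subspZ a x : A x -> A (a *: x).
Proof. by move=> Ax; have := sA.2 a x 0 Ax sA.1; rewrite addr0. Qed.

Lemma subspN x : A x -> A (- x).
Proof. by rewrite -scaleN1r; exact: subspZ. Qed.

Lemma subspB x y : A x -> A y -> A (x - y).
Proof. by move=> Ax Ay; apply/subspD/subspN. Qed.

Lemma subsp_sum (u : nat -> X) n :
  (forall k, A (u k)) -> A (\sum_(k < n) u k).
Proof.
move=> Au; elim: n => [|n IH]; first by rewrite big_ord0; exact: sA.1.
by rewrite big_ord_recr; exact: subspD.
Qed.

Lemma subspace_image S : blin S -> lsubspace (S @` A).
Proof.
move=> bS; split; first by exists 0; [exact: sA.1 | exact: blin0].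
move=> a _ _ [x Ax <-] [y Ay <-]; exists (a *: x + y); first exact: sA.2.
exact: bS.1.
Qed.

End Subspace.

Section TrivialSubspaces.
Variables (R : realType) (X : normedModType R[i]).

Lemma lsubspaceT : lsubspace [set: X].
Proof. by []. Qed.

Lemma lsubspace0 : lsubspace [set 0 : X].
Proof. by split=> // a x y -> ->; rewrite scaler0 addr0. Qed.

Lemma closed_zero : closed [set 0 : X].
Proof.
apply/closed_nrmP => x xe; apply: nrm_small => e /xe[_ ->]; rewrite subr0; lra.
Qed.

End TrivialSubspaces.

(** * Completeness and the open mapping theorem *)

Lemma half_pow_small (R : realType) (B e : R) : 0 <= B -> 0 < e ->
  exists n, forall m, (n <= m)%N -> B * 2^-1 ^+ m < e.
Proof.
move=> B0 e0.
have hS n : 2^-1 ^+ n * n.+1%:R <= 1 :> R.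
  elim: n => [|n IH]; first by rewrite expr0 mulr1.
  rewrite exprS; apply: le_trans IH.
  have : 0 <= 2^-1 ^+ n :> R by rewrite exprn_ge0 // invr_ge0.
  have : (n.+1%:R : R) >= 1 by rewrite ler1n.
  by rewrite -(natr1 n.+1); nra.
have Be : 0 <= B / e by rewrite divr_ge0 // ltW.
exists (Num.bound (B / e)) => m nm.
have := archi_boundP Be; rewrite ltr_pdivrMr // => Bn.
have nm' : (Num.bound (B / e))%:R <= m.+1%:R :> R by rewrite ler_nat leqW.
have := hS m; set h := _ ^+ m => hm.
have h0 : 0 < h by rewrite exprn_gt0 // invr_gt0.
have Bm : B < m.+1%:R * e by nra.
nra.
Qed.

Section Complete.
Variables (R : realType) (X : completeNormedModType R[i]).

Lemma geometric_cvg (u : nat -> X) (B : R) : 0 <= B ->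
  (forall k, nrm (u k) <= B * 2^-1 ^+ k) ->
  exists l, nrm_cvg (fun n => \sum_(k < n) u k) l /\ nrm l <= 2 * B.
Proof.
move=> B0 uB; pose s n := \sum_(k < n) u k.
have h0 n : 0 < 2^-1 ^+ n :> R by rewrite exprn_gt0 // invr_gt0.
have sB n m : nrm (s n - s (n + m)%N) <= 2 * B * (2^-1 ^+ n - 2^-1 ^+ (n + m)).
  elim: m => [|m IH]; first by rewrite addn0 !subrr nrm0 mulr0.
  rewrite addnS /s big_ord_recr /= opprD addrA.
  apply: le_trans (nrmB _ _) _.
  have := uB (n + m)%N; rewrite exprS; move: IH; rewrite /s; nra.
have sB' n m : (n <= m)%N -> nrm (s n - s m) <= 2 * B * 2^-1 ^+ n.
  move=> /subnKC <-; apply: le_trans (sB _ _) _.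
  by have := h0 (n + (m - n))%N; nra.
have [l sl] : exists l, nrm_cvg s l.
  apply: nrm_complete => e e0.
  have [n nB] := @half_pow_small R (2 * B) e ltac:(lra) e0.
  by exists n => m nm; apply: le_lt_trans (nB _ (leqnn n)); exact: sB'.
exists l; split=> //; apply: (nrm_cvg_le sl) => n.
have := sB' _ _ (leq0n n).
by rewrite {1}/s big_ord0 sub0r nrmN expr0 mulr1.
Qed.

(* Newton-type iteration: solving [y = A x + f] up to an error of [nrm y / 2] is
   enough to solve it exactly, since the errors and corrections are summable. *)
Lemma approx_solve (A : X -> X) (D F Y : set X) (C : R) :
  blin A -> lsubspace D -> closed D -> lsubspace F -> closed F -> 0 <= C ->
  (forall y, Y y -> exists x f, [/\ D x, F f, nrm x <= C * nrm y,
     nrm f <= C * nrm y & Y (y - A x - f) /\ nrm (y - A x - f) <= nrm y / 2]) ->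
  forall y, Y y -> exists x f, [/\ D x, F f, nrm x <= 2 * C * nrm y,
     nrm f <= 2 * C * nrm y & y = A x + f].
Proof.
move=> bA sD cD sF cF C0 step y0 Yy0.
have /choice[phi phiP] : forall y, exists xf : X * X, Y y -> [/\ D xf.1, F xf.2,
    nrm xf.1 <= C * nrm y, nrm xf.2 <= C * nrm y &
    Y (y - A xf.1 - xf.2) /\ nrm (y - A xf.1 - xf.2) <= nrm y / 2].
  move=> y; have [/step[x [f h]]|nY] := EM (Y y); first by exists (x, f).
  by exists (0, 0).
(* [w k] is the error left after [k] corrections; each step at least halves it. *)
pose w k := iter k (fun y => y - A (phi y).1 - (phi y).2) y0.
have Yw k : Y (w k) by elim: k => [//|k /phiP[_ _ _ _ []]].
have wB k : nrm (w k) <= nrm y0 * 2^-1 ^+ k.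
  elim: k => [|k IH]; first by rewrite expr0 mulr1.
  by have [_ _ _ _ [_ h]] := phiP _ (Yw k); rewrite exprS; move: h; rewrite /w /=; lra.
have B0 : 0 <= C * nrm y0 by rewrite mulr_ge0 // nrm_ge0.
have [x [xl xB]] : exists l, nrm_cvg (fun n => \sum_(k < n) (phi (w k)).1) l /\
    nrm l <= 2 * (C * nrm y0).
  apply: (geometric_cvg (u := fun k => (phi (w k)).1)) => // k; have [_ _ h _ _] := phiP _ (Yw k).
  by apply: le_trans h _; rewrite -mulrA ler_wpM2l.
have [f [fl fB]] : exists l, nrm_cvg (fun n => \sum_(k < n) (phi (w k)).2) l /\
    nrm l <= 2 * (C * nrm y0).
  apply: (geometric_cvg (u := fun k => (phi (w k)).2)) => // k; have [_ _ _ h _] := phiP _ (Yw k).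
  by apply: le_trans h _; rewrite -mulrA ler_wpM2l.
exists x, f; split; rewrite -?mulrA //.
- by apply: (nrm_cvg_closed cD _ xl) => n; apply: (subsp_sum sD (u := fun k => (phi (w k)).1)) => k;
    have [] := phiP _ (Yw k).
- by apply: (nrm_cvg_closed cF _ fl) => n; apply: (subsp_sum sF (u := fun k => (phi (w k)).2)) => k;
    have [] := phiP _ (Yw k).
apply: nrm_cvg_unique (nrm_cvgD (blin_cvg bA xl) fl).
move=> e e0; have [n nB] := half_pow_small (nrm_ge0 y0) e0.
exists n => m /nB; apply: le_lt_trans; apply: le_trans (wB m); rewrite nrmBC /=.
suff -> : w m = y0 - (A (\sum_(k < m) (phi (w k)).1) + \sum_(k < m) (phi (w k)).2) by [].
elim: m => [|m IH]; first by rewrite !big_ord0 (blin0 bA) addr0 subr0.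
rewrite [LHS]/= -/(w m) {1}IH !big_ord_recr /= (blinD bA).
rewrite !opprD !addrA; apply: (congr1 (fun z => z - _)); exact: addrAC.
Qed.

(** Baire's theorem in the complete space [Y]. Otherwise each ball centred in [Y] contains a smaller
    one that misses a prescribed [A n]; the centres of such nested balls converge to a point of [Y]
    outside every [A n]. *)
Lemma baire_closed (Y : set X) (A : nat -> set X) :
  closed Y -> Y !=set0 -> (forall y, Y y -> exists n, A n y) ->
  exists n y (r : R), [/\ Y y, 0 < r & forall z, Y z -> nrm (z - y) < r ->
    forall e : R, 0 < e -> exists2 a, A n a & nrm (z - a) < e].
Proof.
move=> cY [y0 Yy0] YA; apply: contrapT => nex.
have /choice[phi phiP] : forall q : nat * (X * R), exists q' : X * R,
    Y q.2.1 -> 0 < q.2.2 -> [/\ Y q'.1, 0 < q'.2, q'.2 <= q.2.2 / 2,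
      nrm (q'.1 - q.2.1) + q'.2 <= q.2.2 &
      forall a, A q.1 a -> q'.2 < nrm (q'.1 - a)].
  move=> [n [y r]] /=; apply: contrapT => nq; apply: nex; exists n, y, r.
  have [Yy r0] : Y y /\ 0 < r.
    by apply: contrapT => h; apply: nq; exists (y, r) => Yy r0; case: h.
  split=> // z Yz zy e e0; apply: contrapT => na; apply: nq.
  (* The three bounds keep the new ball off [A n], inside the old ball, and at most half as
     large. *)
  pose d := Num.min (e / 2) (Num.min ((r - nrm (z - y)) / 2) (r / 2)).
  have d1 : d <= e / 2 by rewrite ge_min lexx.
  have d2 : d <= (r - nrm (z - y)) / 2 by rewrite !ge_min lexx !orbT.
  have d3 : d <= r / 2 by rewrite !ge_min lexx !orbT.
  have d0 : 0 < d by rewrite !lt_min; apply/and3P; split; lra.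
  exists (z, d) => _ _ /=; split=> //; first lra.
  move=> a Aa; rewrite ltNge; apply/negP => h.
  by apply: na; exists a => //; lra.
pose p := fix p n := if n is k.+1 then phi (k, p k) else (y0, 1).
have pP n : Y (p n).1 /\ 0 < (p n).2.
  elim: n => [|n [Yn rn]]; first by split => /=.
  by have [] := phiP (n, p n) Yn rn.
have pB n m : (n <= m)%N -> nrm ((p m).1 - (p n).1) + (p m).2 <= (p n).2.
  move=> /subnKC <-; elim: (m - n)%N => [|k IH].
    by rewrite addn0 subrr nrm0 add0r.
  have [_ _ _ h _] := phiP ((n + k)%N, p (n + k)%N) (pP _).1 (pP _).2.
  rewrite addnS /=; move: h => /=; set q := phi _ => h.
  have := nrm_triangle (p (n + k)%N).1 q.1 (p n).1; lra.
have pr n : (p n).2 <= 2^-1 ^+ n.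
  elim: n => [//|n IH].
  have [_ _ h _ _] := phiP (n, p n) (pP _).1 (pP _).2.
  by rewrite exprS; move: h => /=; lra.
have [l pl] : exists l, nrm_cvg (fun n => (p n).1) l.
  apply: nrm_complete => e e0.
  have [n nB] := @half_pow_small R 1 e ltac:(lra) e0.
  exists n => m nm; have := nB _ (leqnn n); have := pB _ _ nm.
  rewrite nrmBC mul1r; have := pr n; have := (pP m).2; lra.
have Yl : Y l by apply: (nrm_cvg_closed cY _ pl) => n; have [] := pP n.
have [n An] := YA _ Yl.
have [_ _ _ _ /(_ _ An)] := phiP (n, p n) (pP _).1 (pP _).2.
(* The limit [l] lies in [A n], yet also in the ball with index [n.+1], which misses [A n]. *)
rewrite -[phi _]/(p n.+1) => h.
have [k /(_ _ (leq_maxl k n.+1)) kl] := pl (nrm ((p n.+1).1 - l) - (p n.+1).2) ltac:(lra).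
have := pB _ _ (leq_maxr k n.+1).
have := nrm_triangle (p (maxn k n.+1)).1 (p n.+1).1 l.
rewrite (nrmBC (p n.+1).1 (p _).1); have := (pP (maxn k n.+1)).2; lra.
Qed.

(** Baire's theorem yields a relative ball of [range A] in which images of vectors of norm at most
    [n] are dense; differences move this ball to the origin, and [approx_solve] removes the
    approximation error. *)
Lemma open_mapping (A : X -> X) : blin A -> closed (range A) ->
  exists2 C : R, 0 <= C &
    forall y, range A y -> exists2 x, A x = y & nrm x <= C * nrm y.
Proof.
move=> bA cA; have sA : lsubspace (range A) by exact: subspace_image.
have [||n [y0 [r [Ay0 r0 dense_n]]]] :=
    @baire_closed (range A) (fun n => [set A x | x in [set x | nrm x <= n%:R]]) cA.
- by exists (A 0), 0.
- move=> _ [x _ <-]; exists (Num.bound (nrm x)), x => //=.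
  by apply/ltW/archi_boundP/nrm_ge0.
have approx y : range A y -> nrm y < r -> exists2 x,
    nrm x <= 2 * n%:R & nrm (y - A x) < r / 4.
  move=> Ay yr.
  have [_ [x1 /= x1n <-] h1] := dense_n y0 Ay0 ltac:(by rewrite subrr nrm0) (r / 8) ltac:(lra).
  have [_ [x2 /= x2n <-] h2] := dense_n (y0 + y) (subspD sA Ay0 Ay) ltac:(by rewrite addrAC subrr add0r) (r / 8) ltac:(lra).
  exists (x2 - x1); first by have := nrmB x2 x1; lra.
  rewrite (blinB bA).
  have -> : y - (A x2 - A x1) = (y0 + y - A x2) - (y0 - A x1).
    by rewrite !opprB addrCA [RHS]addrC -(addrA y0) [RHS]addrA subrK.
  have := nrmB (y0 + y - A x2) (y0 - A x1); lra.
have n0 : 0 <= n%:R :> R by rewrite ler0n.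
pose C : R := 4 * n%:R / r.
have C0 : 0 <= C by rewrite divr_ge0 //; lra.
exists (2 * C); first lra.
move=> y Ay.
have [y' Ay'|x [f [_ -> xB _ yE]]] := approx_solve bA (lsubspaceT X) (@closedT _)
    (lsubspace0 X) (@closed_zero _ X) C0 _ Ay; last first.
  by exists x; rewrite ?[in RHS]yE ?addr0.
have [->|/nrm_gt0 y'0] := EM (y' = 0).
  exists 0, 0; rewrite (blin0 bA) !subr0 nrm0 mulr0; split => //.
  by split; [exact: sA.1 | rewrite mul0r].
(* [t] brings [y'] to norm [r / 2], so that an error below [r / 4] is the factor one half that
   [approx_solve] asks for. *)
pose t : R := r / (2 * nrm y').
have t0 : 0 < t by rewrite divr_gt0 // mulr_gt0.
have tE : t * nrm y' = r / 2 by rewrite /t; field; lra.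
have nt (z : X) : nrm (t%:C%C *: z) = t * nrm z by rewrite nrmZ normcC gtr0_norm.
have [|x xn xr] := approx (t%:C%C *: y') (subspZ sA _ Ay'); first by rewrite nt tE; lra.
have tV : t%:C%C != 0 :> R[i] by rewrite (inj_eq (@complexI R)) gt_eqF.
have xE : x = t%:C%C *: (t%:C%C^-1 *: x) by rewrite scalerA divff // scale1r.
move: xn xr; rewrite xE (blinZ bA) -scalerBr !nt.
set x' := _ *: x => xn xr.
exists x', 0; rewrite subr0 nrm0; split=> //.
- have -> : C * nrm y' = 2 * n%:R / t by rewrite /C /t; field; lra.
  by rewrite ler_pdivlMr // mulrC.
- by rewrite mulr_ge0 // nrm_ge0.
split; first by apply: subspB => //; exists x'.
by rewrite -(ler_pM2l t0); move: xr; lra.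
Qed.

End Complete.

(** * Finite-dimensional subspaces *)

Lemma real_complete (R : realType) (u : nat -> R) :
  (forall e : R, 0 < e -> exists n, forall m, (n <= m)%N ->
     `|u n - u m| < e) ->
  exists l, forall e : R, 0 < e -> exists n, forall m, (n <= m)%N ->
     `|u m - l| < e.
Proof.
move=> cu.
have : cvg (u @ \oo).
  apply/cauchy_cvgP; apply: cauchy_exP => e e0.
  have [n nu] := cu e e0.
  by exists (u n); exists n => // m /= nm; exact: nu.
case/cvg_ex => l ul; exists l => e e0.
have /ul[n _ nu] : nbhs l (ball l e) by exact: nbhsx_ballx.
by exists n => m nm; rewrite distrC; exact: nu.
Qed.

Section Scalars.
Variable R : realType.
Implicit Types c d : R[i].

Lemma normc_ge0 c : 0 <= normc c.
Proof. by case: c => a b; exact: sqrtr_ge0. Qed.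

Lemma normc_Re c : `|complex.Re c| <= normc c.
Proof.
case: c => a b /=; rewrite -sqrtr_sqr ler_sqrt ?lerDl ?sqr_ge0 //.
by rewrite addr_ge0 // sqr_ge0.
Qed.

Lemma normc_Im c : `|complex.Im c| <= normc c.
Proof.
case: c => a b /=; rewrite -sqrtr_sqr ler_sqrt ?lerDr ?sqr_ge0 //.
by rewrite addr_ge0 // sqr_ge0.
Qed.

Lemma normc_le c : normc c <= `|complex.Re c| + `|complex.Im c|.
Proof.
case: c => a b /=; rewrite -[leRHS]ger0_norm ?addr_ge0 // -sqrtr_sqr.
rewrite ler_sqrt ?sqr_ge0 // sqrrD !real_normK ?num_real //.
have : 0 <= `|a| * `|b| by rewrite mulr_ge0.
lra.
Qed.

Lemma scalar_complete (u : nat -> R[i]) :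
  (forall e : R, 0 < e -> exists n, forall m, (n <= m)%N ->
     normc (u n - u m) < e) ->
  exists l, forall e : R, 0 < e -> exists n, forall m, (n <= m)%N ->
     normc (u m - l) < e.
Proof.
move=> cu.
have [a ua] : exists l, forall e : R, 0 < e -> exists n, forall m, (n <= m)%N ->
     `|complex.Re (u m) - l| < e.
  apply: real_complete => e /cu[n nu]; exists n => m /nu; apply: le_lt_trans.
  by rewrite -raddfB; exact: normc_Re.
have [b ub] : exists l, forall e : R, 0 < e -> exists n, forall m, (n <= m)%N ->
     `|complex.Im (u m) - l| < e.
  apply: real_complete => e /cu[n nu]; exists n => m /nu; apply: le_lt_trans.
  by rewrite -raddfB; exact: normc_Im.
exists (Complex a b) => e e0.
have [n1 h1] := ua (e / 2) ltac:(lra); have [n2 h2] := ub (e / 2) ltac:(lra).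
exists (maxn n1 n2) => k; rewrite geq_max => /andP[/h1 ha /h2 hb].
apply: le_lt_trans (normc_le _) _; rewrite !raddfB /=; lra.
Qed.

Lemma real_net (B e : R) : 0 < e ->
  exists l : seq R, forall x, `|x| <= B -> exists2 d, d \in l & `|x - d| <= e.
Proof.
move=> e0; pose n := Num.bound (`|2 * B / e|).
exists [seq - B + e * k%:R | k <- iota 0 n] => x; rewrite ler_norml => /andP[Bx xB].
have t0 : 0 <= (x + B) / e by rewrite divr_ge0 //; lra.
have /andP[kx xk] := truncn_itv t0.
set k := Num.trunc _ in kx xk *.
exists (- B + e * k%:R).
  apply/mapP; exists k => //; rewrite mem_iota /= add0n -(ltr_nat R).
  apply: le_lt_trans kx _; apply: le_lt_trans (archi_boundP (normr_ge0 _)).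
  by apply: le_trans (ler_norm _); rewrite ler_pM2r ?invr_gt0 //; lra.
move: kx xk; rewrite ler_pdivlMr // ltr_pdivrMr // -natr1 => kx xk.
by rewrite ler_norml; apply/andP; split; lra.
Qed.

Lemma scalar_net (B e : R) : 0 < e ->
  exists l : seq R[i], forall c, normc c <= B ->
    exists2 d, d \in l & normc (c - d) <= e.
Proof.
move=> e0; have [l lP] := @real_net B (e / 2) ltac:(lra).
exists [seq Complex a b | a <- l, b <- l] => c cB.
have [a al ca] := lP _ (le_trans (normc_Re c) cB).
have [b bl cb] := lP _ (le_trans (normc_Im c) cB).
exists (Complex a b); first by apply: allpairs_f.
by apply: le_trans (normc_le _) _; rewrite !raddfB /=; lra.
Qed.

End Scalars.

Section Span.
Variables (R : realType) (X : normedModType R[i]).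
Implicit Types (s : seq X) (G A : set X).

(** Recursive form of [in_span]: splitting off one coefficient at a time permits induction on the
    list. *)
Fixpoint lspan s : set X :=
  if s is v :: s' then [set x | exists c, lspan s' (x - c *: v)] else [set 0].

Lemma in_spanP s x : in_span s x <-> lspan s x.
Proof.
elim: s x => [|v s IH] x; split.
- by case=> c ->; rewrite big_ord0.
- by move=> ->; exists (fun=> 0); rewrite big_ord0.
- case=> c ->; exists (c ord0); apply/IH.
  exists (fun i => c (lift ord0 i)).
  by rewrite big_ord_recl /= addrAC subrr add0r.
- case=> c /IH[d xE].
  exists (fun i : 'I_(size s).+1 => oapp d c (unlift ord0 i)).
  rewrite big_ord_recl unlift_none /=.
  under eq_bigr do rewrite liftK.
  by rewrite -xE addrC subrK.
Qed.

Lemma lsubspace_lspan s : lsubspace (lspan s).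
Proof.
elim: s => [|v s [s0 sP]]; first exact: (lsubspace0 X).
split; first by exists 0; rewrite scale0r subr0.
move=> a x y [c xs] [d ys]; exists (a * c + d).
have := sP a _ _ xs ys; congr (lspan _ _).
by rewrite scalerDl scalerBr scalerA opprD addrACA.
Qed.

Lemma lspan_cons v s : lspan s `<=` lspan (v :: s).
Proof. by move=> x xs; exists 0; rewrite scale0r subr0. Qed.

Lemma lspan_mem s x : x \in s -> lspan s x.
Proof.
elim: s => [//|v s IH]; rewrite inE => /orP[/eqP ->|/IH]; last exact: lspan_cons.
by exists 1; rewrite scale1r subrr; exact: (lsubspace_lspan s).1.
Qed.

Lemma lspan_sub A s : lsubspace A -> (forall x, x \in s -> A x) -> lspan s `<=` A.
Proof.
move=> sA; elim: s => [|v s IH] sub x; first by move=> ->; exact: sA.1.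
case=> c /IH h; rewrite -(subrK (c *: v) x); apply: subspD => //.
  by apply: h => y ys; apply: sub; rewrite inE ys orbT.
by apply: subspZ => //; apply: sub; rewrite mem_head.
Qed.

Lemma lspan_image S s x : blin S -> lspan s x -> lspan (map S s) (S x).
Proof.
move=> bS; elim: s x => [|v s IH] x /=; first by move=> ->; exact: blin0.
by case=> c /IH; rewrite (blinB bS) (blinZ bS) => h; exists c.
Qed.

Lemma lsubspace_fin A s : lsubspace A -> A `<=` lspan s ->
  exists s', A = lspan s'.
Proof.
move=> sA; elim: s A sA => [|v s IH] A sA As.
  by exists [::]; apply/seteqP; split => // x ->; exact: sA.1.
have [A's|/existsNP[w /not_implyP[Aw nw]]] := EM (A `<=` lspan s); first exact: IH.
have sI : lsubspace (A `&` lspan s).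
  split; first by split; [exact: sA.1 | exact: (lsubspace_lspan s).1].
  by move=> a x y [Ax sx] [Ay sy]; split; [exact: sA.2 | exact: (lsubspace_lspan s).2].
have [s' s'E] := IH _ sI (@subIsetr _ _ _).
have [c wc] := As _ Aw.
have c0 : c != 0 by apply/eqP => c0; apply: nw; move: wc; rewrite c0 scale0r subr0.
exists (w :: s'); apply/seteqP; split=> x.
- move=> Ax; have [d xd] := As _ Ax; exists (d / c); rewrite -s'E; split.
    by apply: subspB => //; apply: subspZ.
  have := (lsubspace_lspan s).2 (- (d / c)) _ _ wc xd; congr (lspan _ _).
  rewrite scaleNr scalerBr scalerA divfK // opprB.
  by rewrite addrC addrA subrK.
- case=> d xd; have [Axd _] : (A `&` lspan s) (x - d *: w) by rewrite s'E.
  by rewrite -(subrK (d *: w) x); apply: subspD => //; apply: subspZ.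
Qed.

(** Induction on the list replaces a dimension count. The traces on [lspan s] stabilize; if no [A k]
    lies in [lspan s], a multiple of a vector of [A k] with nonzero coefficient along [v] moves any
    element of [A k0] into the stable trace. *)
Lemma decreasing_subspaces_stabilize (A : nat -> set X) s :
  (forall k, lsubspace (A k)) -> (forall k, A k.+1 `<=` A k) -> A 0%N `<=` lspan s ->
  exists k0, forall k, (k0 <= k)%N -> A k = A k0.
Proof.
elim: s A => [|v s IH] A sA dA A0.
  have Ak k : A k = [set 0].
    apply/seteqP; split; last by move=> x ->; exact: (sA k).1.
    by move=> x Ax; apply: A0; elim: k Ax => [//|k IHk /dA].
  by exists 0%N => k _; rewrite !Ak.
have dA' k m : (k <= m)%N -> A m `<=` A k.
  by move=> /subnKC <-; elim: (m - k)%N => [|j IHj]; rewrite ?addn0 // addnS => x /dA /IHj.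
have sI k : lsubspace (A k `&` lspan s).
  split; first by split; [exact: (sA k).1 | exact: (lsubspace_lspan s).1].
  by move=> a x y [Ax sx] [Ay sy]; split; [exact: (sA k).2 | exact: (lsubspace_lspan s).2].
have [|k0 k0P] := IH (fun k => A k `&` lspan s) sI _ (@subIsetr _ _ _).
  by move=> k x [/dA Ax ?].
have [[k1 k1s]|nk] := EM (exists k, A k `<=` lspan s).
  exists (maxn k0 k1) => k; rewrite geq_max => /andP[kk0 kk1].
  have AI j : (k1 <= j)%N -> A j = A j `&` lspan s.
    by move=> jk; apply/esym/setIidPl => x /(dA' _ _ jk) /k1s.
  by rewrite AI // (k0P _ kk0) -(k0P _ (leq_maxl k0 k1)) -AI // leq_maxr.
exists k0 => k kk0; apply/seteqP; split; first exact: dA'.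
move=> x Ax.
have /existsNP[w /not_implyP[Aw nw]] : ~ (A k `<=` lspan s) by move=> h; apply: nk; exists k.
have [c wc] := A0 _ (dA' _ _ (leq0n k) _ Aw).
have [d xd] := A0 _ (dA' _ _ (leq0n k0) _ Ax).
have c0 : c != 0 by apply/eqP => c0; apply: nw; move: wc; rewrite c0 scale0r subr0.
have : (A k0 `&` lspan s) (x - (d / c) *: w).
  split; first by apply: (subspB (sA k0)) => //; apply: (subspZ (sA k0)); exact: dA' Aw.
  have := (lsubspace_lspan s).2 (- (d / c)) _ _ wc xd; congr (lspan _ _).
  rewrite scaleNr scalerBr scalerA divfK // opprB.
  by rewrite addrC addrA subrK.
rewrite -(k0P _ kk0) => -[Axw _].
by rewrite -(subrK ((d / c) *: w) x); apply: (subspD (sA k)) => //; apply: (subspZ (sA k)).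
Qed.

(** * Sums of a closed subspace and a finite-dimensional one *)

Definition sumsp G s : set X := [set x | exists2 f, lspan s f & G (x - f)].

Lemma lsubspace_sumsp G s : lsubspace G -> lsubspace (sumsp G s).
Proof.
move=> sG; split; first by exists 0; rewrite ?subr0; [exact: (lsubspace_lspan s).1|exact: sG.1].
move=> a x y [f fs Gf] [g gs Gg]; exists (a *: f + g).
  exact: (lsubspace_lspan s).2.
have := sG.2 a _ _ Gf Gg; congr (G _).
by rewrite scalerBr opprD addrACA.
Qed.

Lemma sumsp_cons G v s x :
  sumsp G (v :: s) x <-> exists c, sumsp G s (x - c *: v).
Proof.
split.
- case=> f [c fs] Gf; exists c, (f - c *: v) => //.
  by rewrite opprB addrA subrK.
- case=> c [f fs Gf]; exists (f + c *: v); first by exists c; rewrite addrK.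
  by move: Gf; congr (G _); rewrite opprD addrA addrAC.
Qed.

Lemma sumsp0 s : sumsp [set 0] s = lspan s.
Proof.
apply/seteqP; split=> x; last by move=> xs; exists x; rewrite //= subrr.
by case=> f fs /= /eqP; rewrite subr_eq0 => /eqP ->.
Qed.

Lemma closed_dist G v : closed G -> ~ G v ->
  exists2 d : R, 0 < d & forall g, G g -> d <= nrm (v - g).
Proof.
move=> /closed_nrmP cG nv; apply: contrapT => nd; apply: nv; apply: cG => e e0.
apply: contrapT => ne; apply: nd; exists e => // g Gg.
by rewrite leNgt; apply/negP => h; apply: ne; exists g.
Qed.

(** The coordinate along [v] is continuous: for [c] nonzero, dividing [x - c *: v] by [- c] exhibits
    an element of [G] at distance [nrm x / normc c] from [v]. *)
Lemma coef_bound G v : closed G -> lsubspace G -> ~ G v ->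
  exists2 d : R, 0 < d & forall c x, G (x - c *: v) -> normc c * d <= nrm x.
Proof.
move=> cG sG nv; have [d d0 dP] := closed_dist cG nv; exists d => // c x Gx.
have [->|c0] := eqVneq c 0; first by rewrite normc0 mul0r nrm_ge0.
have := dP _ (subspZ sG (- c^-1) Gx).
rewrite scaleNr opprK scalerBr scalerA mulVf // scale1r addrCA subrr addr0 nrmZ normcV.
have nc : 0 < normc c.
  rewrite lt_neqAle normc_ge0 andbT eq_sym.
  by apply: contra c0 => /eqP/eq0_normc ->.
by rewrite ler_pdivlMl // mulrC.
Qed.

(** If vectors [g + c *: v] with [g] in [G] tend to [x], their coefficients [c] are Cauchy by
    [coef_bound], so the vectors [g] converge too, within [G]. *)
Lemma closed_add_line G v : closed G -> lsubspace G -> ~ G v ->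
  closed [set x | exists c, G (x - c *: v)].
Proof.
move=> cG sG nv; have [d d0 dP] := coef_bound cG sG nv.
apply/closed_nrmP => x xcl.
have /choice[y yP] : forall n, exists y : X * R[i], G (y.1 - y.2 *: v) /\
    nrm (x - y.1) < 2^-1 ^+ n.
  move=> n; have [|z [c Gz] xz] := xcl (2^-1 ^+ n); first by rewrite exprn_gt0 // invr_gt0.
  by exists (z, c).
have h2 n m : (n <= m)%N -> 2^-1 ^+ m <= 2^-1 ^+ n :> R.
  by move=> nm; rewrite ler_wiXn2l // ?invr_ge0 //; lra.
have [c cl] : exists l, forall e : R, 0 < e -> exists n, forall m, (n <= m)%N ->
    normc ((y m).2 - l) < e.
  apply: scalar_complete => e e0.
  have [n nB] := @half_pow_small R 2 (e * d) ltac:(lra) (mulr_gt0 e0 d0).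
  exists n => m nm; rewrite -(ltr_pM2r d0).
  have /dP : G (((y n).1 - (y m).1) - ((y n).2 - (y m).2) *: v).
    have := subspB sG (yP n).1 (yP m).1; congr (G _).
    by rewrite scalerBl !opprB [X in _ + X = _]addrC addrACA [X in _ + X = _]addrC.
  move/le_lt_trans; apply.
  have := nrm_triangle x (y n).1 (y m).1; rewrite (nrmBC _ x).
  have := (yP n).2; have := (yP m).2; have := h2 _ _ nm; have := nB _ (leqnn n).
  lra.
exists c; move/closed_nrmP: cG; apply => e e0.
have v0 := nrm_ge0 v.
have [n1 h1] := cl (e / (2 * (nrm v + 1))) ltac:(rewrite divr_gt0 //; lra).
have [n2 nB] := @half_pow_small R 1 (e / 2) ltac:(lra) ltac:(lra).
have a := h1 _ (leq_maxl n1 n2); have b := nB _ (leq_maxr n1 n2).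
set n := maxn n1 n2 in a b.
exists ((y n).1 - (y n).2 *: v); first exact: (yP n).1.
have -> : x - c *: v - ((y n).1 - (y n).2 *: v) =
    (x - (y n).1) + ((y n).2 - c) *: v.
  by rewrite scalerBl opprB [X in _ + X = _]addrC addrACA [X in _ + X = _]addrC.
apply: le_lt_trans (nrmD _ _) _; rewrite nrmZ.
move: a; rewrite ltr_pdivlMr; last lra.
have := (yP n).2; have := normc_ge0 ((y n).2 - c); nra.
Qed.

(** Vectors are added one at a time. The bound [C] controls the finite-dimensional summand, as the
    compactness argument of [gap_finite] and the iteration of [approx_solve] require. *)
Lemma closed_sumsp G s : closed G -> lsubspace G ->
  closed (sumsp G s) /\ exists2 C : R, 0 <= C & forall y, sumsp G s y ->
    exists f, [/\ lspan s f, G (y - f) & nrm f <= C * nrm y].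
Proof.
move=> cG sG; elim: s => [|v s [cs [C C0 CP]]].
  have -> : sumsp G [::] = G.
    apply/seteqP; split=> x; first by case=> f -> /=; rewrite subr0.
    by move=> Gx; exists 0; rewrite ?subr0.
  split=> //; exists 0 => // y Gy; exists 0; rewrite subr0 nrm0 mul0r; split => //.
have ss := lsubspace_sumsp s sG.
have consE : sumsp G (v :: s) = [set x | exists c, sumsp G s (x - c *: v)].
  by apply/seteqP; split=> x /sumsp_cons.
rewrite consE; have [Gv|nGv] := EM (sumsp G s v).
  have -> : [set x | exists c, sumsp G s (x - c *: v)] = sumsp G s.
    apply/seteqP; split=> x; last by move=> h; exists 0; rewrite scale0r subr0.
    by case=> c h; rewrite -(subrK (c *: v) x); apply: (subspD ss) => //; apply: (subspZ ss).
  split=> //; exists C => // y /CP[f [fs Gf fC]]; exists f; split=> //.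
  exact: lspan_cons.
split; first exact: closed_add_line.
have [d d0 dP] := coef_bound cs ss nGv.
have v0 := nrm_ge0 v.
pose k := nrm v / d; have k0 : 0 <= k by rewrite divr_ge0 // ltW.
exists (C * (1 + k) + k) => [|y [c yc]]; first by rewrite addr_ge0 // mulr_ge0 // addr_ge0.
have [f [fs Gf fC]] := CP _ yc; exists (f + c *: v); split.
- by exists c; rewrite addrK.
- by move: Gf; congr (G _); rewrite opprD addrA addrAC.
have cv : nrm (c *: v) <= k * nrm y.
  rewrite nrmZ /k mulrAC ler_pdivlMr //.
  have := dP _ _ yc; nra.
have := nrmD f (c *: v); have := nrmB y (c *: v) => h1 h2.
have : C * nrm (y - c *: v) <= C * ((1 + k) * nrm y) by rewrite ler_wpM2l //; lra.
lra.
Qed.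

Lemma closed_lspan s : closed (lspan s).
Proof. by rewrite -sumsp0; apply: (closed_sumsp s (@closed_zero _ X) (lsubspace0 X)).1. Qed.

(** Total boundedness of balls in finite dimension: [coef_bound] bounds the coefficient of [v], and
    nets for it and for the remainder combine. *)
Lemma lspan_net s (C e : R) : 0 < e -> exists l : seq X,
  forall f, lspan s f -> nrm f <= C -> exists2 v, v \in l & nrm (f - v) <= e.
Proof.
elim: s C e => [|v s IH] C e e0.
  by exists [:: 0] => f -> _; exists 0; rewrite ?mem_head // subrr nrm0 ltW.
have [sv|nsv] := EM (lspan s v).
  have [l lP] := IH C e e0; exists l => f [c fs] fC; apply: lP => //.
  rewrite -(subrK (c *: v) f); apply: (subspD (lsubspace_lspan s)) => //.
  exact: (subspZ (lsubspace_lspan s)).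
have [d d0 dP] := coef_bound (@closed_lspan s) (lsubspace_lspan s) nsv.
have v0 := nrm_ge0 v.
have [lc lcP] := @scalar_net R (C / d) (e / (2 * (nrm v + 1))) ltac:(rewrite divr_gt0 //; lra).
have [l lP] := IH (C + C / d * nrm v) (e / 2) ltac:(lra).
exists [seq c *: v + y | c <- lc, y <- l] => f [c fs] fC.
have cB : normc c <= C / d by rewrite ler_pdivlMr //; exact: le_trans (dP _ _ fs) fC.
have [c' c'l cc'] := lcP _ cB.
have [|y yl fy] := lP _ fs.
  apply: le_trans (nrmB _ _) _; rewrite nrmZ lerD // ler_wpM2r //.
exists (c' *: v + y); first by apply: allpairs_f.
have -> : f - (c' *: v + y) = (f - c *: v - y) + (c - c') *: v.
  by rewrite scalerBl opprD addrACA (addrC _ (- (c' *: v))) [in RHS]addrCA [in RHS]addrA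
     -!addrA addKr addrCA.
apply: le_trans (nrmD _ _) _; rewrite nrmZ.
move: cc'; rewrite ler_pdivlMr; last lra.
have := normc_ge0 (c - c'); nra.
Qed.

Lemma riesz G x : closed G -> lsubspace G -> ~ G x ->
  exists g a, [/\ G g, nrm (a *: (x - g)) <= 1 &
    forall g', G g' -> 2^-1 <= nrm (a *: (x - g) - g')].
Proof.
move=> cG sG nx; have [d0 d00 d0P] := closed_dist cG nx.
pose E : set R := [set nrm (x - g) | g in G].
have iE : has_inf E.
  split; first by exists (nrm (x - 0)), 0 => //; exact: sG.1.
  by exists d0 => _ [g Gg <-]; exact: d0P.
have E0 : 0 < inf E.
  by apply: lt_le_trans d00 _; apply: lb_le_inf; [exact: iE.1 | move=> _ [g Gg <-]; exact: d0P].
(* Taking the infimum itself as tolerance gives [nrm (x - g) < 2 * inf E], whence the constant one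
   half after normalization. *)
have [_ [g Gg <-] gE] := inf_adherent E0 iE.
have EP g' : G g' -> inf E <= nrm (x - g').
  by move=> Gg'; apply: ge_inf; [exact: iE.2 | exists g'].
have xg0 : 0 < nrm (x - g) by apply: lt_le_trans E0 (EP _ Gg).
pose t := (nrm (x - g))^-1.
have t0 : 0 < t by rewrite invr_gt0.
exists g, (t%:C%C); split=> //.
  by rewrite nrmZ normcC gtr0_norm // /t mulVf // gt_eqF.
move=> g' Gg'.
have tV : t%:C%C != 0 :> R[i] by rewrite (inj_eq (@complexI R)) gt_eqF.
have -> : t%:C%C *: (x - g) - g' = t%:C%C *: (x - (g + t%:C%C^-1 *: g')).
  by rewrite !(scalerBr, scalerDr) scalerA divff // scale1r opprD addrA.
rewrite nrmZ normcC gtr0_norm //.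
have := EP _ (subspD sG Gg (subspZ sG t%:C%C^-1 Gg')).
set q := nrm _ => hq.
rewrite mulrC ler_pdivlMr //; lra.
Qed.

(* If M were not of finite codimension over G, Riesz's lemma would give an
   infinite sequence in the unit ball of M that is 1/2-separated modulo G. The
   associated vectors f lie in a bounded, hence totally bounded, part of
   [lspan s], so two of them are e-close, which contradicts the separation. *)
Lemma gap_finite (M G : set X) (P : X -> X -> Prop) s (C e : R) :
  lsubspace M -> closed G -> lsubspace G -> G `<=` M -> 0 < e ->
  (forall x, M x -> nrm x <= 1 -> exists f, [/\ lspan s f, nrm f <= C & P x f]) ->
  (forall x f x' f', P x f -> P x' f' -> nrm (f - f') <= e ->
     exists2 g, G g & nrm (x - x' - g) < 2^-1) ->
  exists s', M `<=` sumsp G s'.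
Proof.
move=> sM cG sG GM e0 MP PG; apply: contrapT => nfin.
have /choice[z zP] : forall l : seq X, exists z, (forall x, x \in l -> M x) ->
    [/\ M z, nrm z <= 1 & forall y, sumsp G l y -> 2^-1 <= nrm (z - y)].
  move=> l; have [lM|nlM] := EM (forall x, x \in l -> M x); last by exists 0.
  have /existsNP[x /not_implyP[Mx nx]] : ~ (M `<=` sumsp G l).
    by move=> h; apply: nfin; exists l.
  have [g [a [Gg z1 zd]]] := riesz (closed_sumsp l cG sG).1 (lsubspace_sumsp l sG) nx.
  exists (a *: (x - g)) => _; split=> //; apply: subspZ => //; apply: subspB => //.
  case: Gg => f fl Gf; rewrite -(subrK f g); apply: subspD => //; first exact: GM.
  exact: (lspan_sub sM lM).
(* [l n] lists the first [n] chosen vectors, newest first; each new one is separated from [G] plus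
   the span of the earlier ones. *)
pose l := fix l n := if n is k.+1 then z (l k) :: l k else [::].
have lM n : forall x, x \in l n -> M x.
  elim: n => [//|n IH] x; rewrite inE => /orP[/eqP ->|]; last exact: IH.
  by have [] := zP _ IH.
have zl i j : (i < j)%N -> z (l i) \in l j.
  elim: j => [//|j IH]; rewrite ltnS leq_eqVlt inE => /orP[/eqP ->|/IH ->].
    by rewrite eqxx.
  by rewrite orbT.
have [t tP] := lspan_net s C (divr_gt0 e0 (ltr0Sn R 1)).
have /choice[f fP] : forall i, exists f, [/\ lspan s f, nrm f <= C & P (z (l i)) f].
  by move=> i; have [Mz z1 _] := zP _ (lM i); exact: MP.
have /choice[v vP] : forall i, exists v, v \in t /\ nrm (f i - v) <= e / 2.
  by move=> i; have [fs fC _] := fP i; have [v vt vf] := tP _ fs fC; exists v.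
have idx i : (index (v i) t < size t)%N by rewrite index_mem; have [] := vP i.
have [i [j [ij vij]]] : exists i j, (i < j)%N /\ v i = v j.
  pose c (i : 'I_(size t).+1) : 'I_(size t) := Ordinal (idx i).
  have /injectivePn[i [j ij cij]] : ~~ injectiveb c.
    apply/negP => /injectiveP /leq_card; rewrite !card_ord ltnn //.
  have vE : v i = v j.
    have := congr1 (nth 0 t \o val) cij; rewrite /= !nth_index //; first by have [] := vP j.
    by have [] := vP i.
  case: (ltngtP i j) => h; [by exists i, j | by exists j, i | by case/eqP: ij; apply: val_inj].
have [_ _ Pi] := fP i; have [_ _ Pj] := fP j.
have [|g Gg zg] := PG _ _ _ _ Pj Pi.
  have := nrm_triangle (v i) (f j) (f i); rewrite (nrmBC (v i)).
  have := (vP i).2; have := (vP j).2; rewrite vij; lra.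
have [_ _ /(_ (z (l i) + g)) h] := zP _ (lM j).
have : sumsp G (l j) (z (l i) + g).
  by exists (z (l i)); [apply: lspan_mem; exact: zl | rewrite addrAC subrr add0r].
move/h; rewrite opprD addrA; lra.
Qed.

End Span.

(** * Powers and small shifts of an operator *)

Section FiniteDim.
Variables (R : realType) (X : normedModType R[i]).
Implicit Types (s t : seq X) (A Z : set X).

Lemma fin_dimP A : fin_dim A <-> exists s, A `<=` lspan s.
Proof. by split=> -[s sP]; exists s => x /sP /in_spanP. Qed.

Lemma lspan_cat s t x y : lspan s x -> lspan t y -> lspan (s ++ t) (x + y).
Proof.
elim: s x => [|v s IH] x; first by move=> -> ty; rewrite add0r.
by case=> c /IH h /h; rewrite addrAC => ?; exists c.
Qed.

Lemma lspan_preimage (B : X -> X) s : blin B -> lspan s `<=` range B ->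
  exists u, forall z, lspan s z -> exists2 w, lspan u w & B w = z.
Proof.
move=> bB; elim: s => [|v s IH] sB.
  by exists [::] => z ->; exists 0 => //; exact: blin0.
have [u uP] := IH (subset_trans (@lspan_cons _ _ v s) sB).
have [w _ wv] := sB _ (lspan_mem (mem_head v s)).
exists (w :: u) => z [c /uP[y yu yz]]; exists (y + c *: w); first by exists c; rewrite addrK.
by rewrite (blinD bB) (blinZ bB) wv yz subrK.
Qed.

(** Lifts of vectors spanning the part of [Z] in the range of [B], together with [t] for the kernel,
    have a span containing the preimage. *)
Lemma fin_preimage (B : X -> X) Z s t : blin B -> lsubspace Z ->
  Z `<=` lspan s -> Defs.kernel B `<=` lspan t ->
  exists t', [set x | Z (B x)] `<=` lspan t'.
Proof.
move=> bB sZ Zs Bt; have sB := subspace_image (lsubspaceT X) bB.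
have sI : lsubspace (Z `&` range B).
  split; first by split; [exact: sZ.1 | exact: sB.1].
  by move=> a x y [? ?] [? ?]; split; [exact: sZ.2 | exact: sB.2].
have [s' s'E] := lsubspace_fin sI (subset_trans (@subIsetl _ _ _) Zs).
have [|u uP] := @lspan_preimage B s' bB; first by rewrite -s'E; exact: subIsetr.
exists (u ++ t) => x /= ZBx.
have /uP[w wu wx] : lspan s' (B x) by rewrite -s'E; split => //; exists x.
rewrite -(subrK w x) addrC; apply: lspan_cat => //; apply: Bt.
by rewrite /Defs.kernel /= (blinB bB) wx subrr.
Qed.

End FiniteDim.

Section Operator.
Variables (R : realType) (X : completeNormedModType R[i]) (S : X -> X).
Hypothesis bS : blin S.
Local Notation rg n := (range (iter n S)).
Local Notation ker n := (Defs.kernel (iter n S)).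
Local Notation sh mu := (Defs.shift S mu).

Lemma lsubspace_rg n : lsubspace (rg n).
Proof. exact (subspace_image (lsubspaceT X) (blin_iter bS n)). Qed.

Lemma lsubspace_kernel : lsubspace (Defs.kernel S).
Proof.
split; first exact: blin0.
by move=> a x y /= Sx Sy; rewrite /Defs.kernel /= bS.1 Sx Sy scaler0 addr0.
Qed.

Lemma rgS n : S @` rg n = rg n.+1.
Proof.
apply/seteqP; split=> [_ [_ [x _ <-] <-]|_ [x _ <-]]; first by exists x.
by exists (iter n S x) => //; exists x.
Qed.

Lemma rg_sub n m : (n <= m)%N -> rg m `<=` rg n.
Proof.
by move=> /subnKC <- _ [x _ <-]; exists (iter (m - n) S x) => //; rewrite -iterD.
Qed.

Lemma iter_shift mu n x : iter n S (sh mu x) = sh mu (iter n S x).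
Proof.
rewrite /Defs.shift (blinB (blin_iter bS n)) (blinZ (blin_iter bS n)).
by rewrite -iterSr -iterS.
Qed.

Lemma rg_shift mu n x : rg n x -> rg n (sh mu x).
Proof. by move=> [y _ <-]; exists (sh mu y) => //; rewrite iter_shift. Qed.

(* S and S - mu are coprime, so S^n is invertible modulo S - mu. *)
Lemma shift_coprime mu n x : mu != 0 ->
  exists w, x - mu ^- n *: iter n S x = sh mu w.
Proof.
move=> mu0; elim: n => [|n [w wE]].
  by exists 0; rewrite expr0 invr1 scale1r subrr (blin0 (blin_shift bS mu)).
exists (w - mu ^- n.+1 *: iter n S x).
rewrite (blinB (blin_shift bS mu)) -wE (blinZ (blin_shift bS mu)) /Defs.shift /=.
rewrite scalerBr scalerA.
have -> : mu ^- n.+1 * mu = mu ^- n by rewrite exprS invfM mulrAC mulVf // mul1r.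
by rewrite opprB addrA subrK.
Qed.

Lemma shift_onto_kernel mu n z : mu != 0 -> ker n z -> exists w, z = sh mu w.
Proof.
move=> mu0 zn; have [w] := shift_coprime n z mu0.
by rewrite zn scaler0 subr0; exists w.
Qed.

(** An eigenvector for [mu] satisfies [iter n S x = mu ^+ n *: x], and [mu ^+ n] can be divided
    out. *)
Lemma kernel_shift_sub mu n : mu != 0 -> Defs.kernel (sh mu) `<=` rg n.
Proof.
move=> mu0 x /eqP; rewrite subr_eq0 => /eqP Sx.
have Snx : iter n S x = mu ^+ n *: x.
  elim: n => [|n IH]; first by rewrite scale1r.
  by rewrite /= IH (blinZ bS) Sx scalerA exprSr.
exists (mu ^- n *: x) => //; rewrite (blinZ (blin_iter bS n)) Snx scalerA.
by rewrite mulVf ?scale1r // expf_neq0.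
Qed.

(** If [y] is a limit of values of [sh mu], then [iter n S y] is [sh mu] applied to some
    [iter n S x], so [y - sh mu x] lies in the kernel of [iter n S], which is contained in the range
    of [sh mu]. *)
Lemma closed_range_shift mu n : mu != 0 ->
  closed (sh mu @` rg n) -> closed (range (sh mu)).
Proof.
move=> mu0 /closed_nrmP cn; apply/closed_nrmP => y ycl.
have bn := blin_iter bS n.
have [_ [x _ <-] xy] : (sh mu @` rg n) (iter n S y).
  apply: cn => e e0; case: bn.2 => C C0 CP.
  have [|_ [x _ <-] yx] := ycl (e / (C + 1)); first by rewrite divr_gt0 //; lra.
  exists (sh mu (iter n S x)); first by exists (iter n S x) => //; exists x.
  rewrite -iter_shift -(blinB bn); apply: le_lt_trans (CP _) _.
  move: yx; rewrite ltr_pdivlMr; last lra.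
  have := nrm_ge0 (y - sh mu x); nra.
have [|w wE] := @shift_onto_kernel mu n (y - sh mu x) mu0.
  by rewrite /Defs.kernel /= (blinB bn) iter_shift xy subrr.
exists (w + x) => //; rewrite (blinD (blin_shift bS mu)) -wE subrK //.
Qed.

(** The open mapping theorem is applied to [iter n.+1 S] on all of [X], because [rg n] is not known
    to be closed. *)
Lemma rg_bounded_preimage n : closed (rg n.+1) -> exists2 C : R, 0 <= C &
  forall y, rg n.+1 y -> exists x, [/\ rg n x, S x = y & nrm x <= C * nrm y].
Proof.
move=> /(open_mapping (blin_iter bS n.+1))[C C0 CP].
case: (blin_iter bS n).2 => D D0 DP.
exists (D * C); first exact: mulr_ge0.
move=> y /CP[x xy xC]; exists (iter n S x); split => //.
by apply: le_trans (DP _) _; rewrite -mulrA ler_wpM2l.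
Qed.

(** With [N] the finite-dimensional kernel of [S] in [M], the sum [A + N] is closed. If [S a] is
    close to [y = S m], a small preimage of [S (m - a)] shows that [m] is close to [A + N], hence in
    it. *)
Lemma closed_image (M A : set X) (C : R) s :
  lsubspace M -> 0 <= C ->
  (forall y, (S @` M) y -> exists x, [/\ M x, S x = y & nrm x <= C * nrm y]) ->
  closed (S @` M) -> M `&` Defs.kernel S `<=` lspan s ->
  lsubspace A -> closed A -> A `<=` M -> closed (S @` A).
Proof.
move=> sM C0 CP /closed_nrmP cSM Ns sA cA AM.
have sN : lsubspace (M `&` Defs.kernel S).
  have sk := lsubspace_kernel.
  split; first by split; [exact: sM.1 | exact: sk.1].
  by move=> a x y [? ?] [? ?]; split; [exact: sM.2 | exact: sk.2].
have [t tE] := lsubspace_fin sN Ns.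
apply/closed_nrmP => y ycl.
have [m Mm my] : (S @` M) y.
  apply: cSM => e /ycl[_ [a Aa <-] ya]; exists (S a) => //.
  by exists a => //; exact: AM.
have /closed_nrmP ct := (closed_sumsp t cA sA).1.
have [f ft Af] : sumsp A t m.
  apply: ct => e e0.
  have [|_ [a Aa <-] ya] := ycl (e / (C + 1)); first by rewrite divr_gt0 //; lra.
  have Mma : M (m - a) by apply: subspB => //; exact: AM.
  have [|x [Mx xE xC]] := CP (S (m - a)); first by exists (m - a).
  exists (m - x); last first.
    rewrite opprB addrCA subrr addr0; apply: le_lt_trans xC _.
    rewrite (blinB bS) my; move: ya; rewrite ltr_pdivlMr; last lra.
    have := nrm_ge0 (y - S a); nra.
  exists (m - x - a); last by rewrite opprB addrCA subrr addr0.
  rewrite -tE addrAC; split; first exact: subspB.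
  by rewrite /Defs.kernel /= (blinB bS (m - a)) xE subrr.
exists (m - f) => //; move: ft; rewrite -tE => -[_ Sf].
by rewrite (blinB bS) Sf subr0.
Qed.

Lemma closed_rg_up n s : closed (rg n) -> closed (rg n.+1) ->
  rg n `&` Defs.kernel S `<=` lspan s -> forall m, (n <= m)%N -> closed (rg m).
Proof.
move=> cn cn1 ns m /subnKC <-; elim: (m - n)%N => [|k IH]; first by rewrite addn0.
have [C C0 CP] := rg_bounded_preimage cn1.
rewrite addnS -rgS; apply: (@closed_image (rg n) _ C s) => //; rewrite ?rgS //.
- exact: lsubspace_rg.
- exact: lsubspace_rg.
- exact/rg_sub/leq_addr.
Qed.

(** * Ascent, and the passage between the Fredholm classes *)

Lemma ker_sub n m : (n <= m)%N -> ker n `<=` ker m.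
Proof.
move=> /subnK <- x xn; rewrite /Defs.kernel /= iterD xn.
exact: blin0 (blin_iter bS _).
Qed.

Lemma ker_stable p m : ker p = ker p.+1 -> (p <= m)%N -> ker m = ker p.
Proof.
move=> pE /subnKC <-; elim: (m - p)%N => [|k IH]; first by rewrite addn0.
rewrite addnS -IH; apply/seteqP; split; last by apply: ker_sub.
move=> x xk; have : ker p.+1 (iter k S x) by rewrite /Defs.kernel /= -iterS -iterD addSn.
by rewrite -pE /Defs.kernel /= -iterD.
Qed.

Lemma finite_ascent_min : finite_ascent S -> exists p, ker p = ker p.+1 /\
  forall m, (m < p)%N -> ker m <> ker m.+1.
Proof.
case=> n nE.
have ex : exists n, `[< ker n = ker n.+1 >] by exists n; apply/asboolP.
have [p /asboolP pE pmin] := ex_minnP ex.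
exists p; split=> // m mp mE; have := pmin m; rewrite leqNgt mp => h.
by apply/notF/h/asboolP.
Qed.

Lemma ker_rg_inj p m x : ker p = ker p.+1 -> (p <= m)%N ->
  rg m x -> S x = 0 -> x = 0.
Proof.
move=> pE pm [y _ <-] Sy.
have : ker m.+1 y by [].
by rewrite (ker_stable pE (leqW pm)) -(ker_stable pE pm).
Qed.

(* As ker S^k = ker S^(k+1), the small preimages under S^(k+1) given by the open
   mapping theorem bound S^k x by S^(k+1) x: S is bounded below on rg k. *)
Lemma closed_rg_down k : ker k = ker k.+1 -> closed (rg k.+1) ->
  closed (rg k) /\ exists2 C : R, 0 <= C &
    forall x, rg k x -> nrm x <= C * nrm (S x).
Proof.
move=> kE ck.
have [C C0 CP] := rg_bounded_preimage ck.
have CB x : rg k x -> nrm x <= C * nrm (S x).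
  move=> kx; have [|x' [kx' Sx' x'C]] := CP (S x); first by rewrite -rgS; exists x.
  suff xE : x' = x by rewrite -[in leLHS]xE.
  apply/eqP; rewrite -subr_eq0; apply/eqP; apply: (ker_rg_inj kE (leqnn k)).
    exact: (subspB (lsubspace_rg k)).
  by rewrite (blinB bS) Sx' subrr.
split; last by exists C.
apply/closed_nrmP => y ycl; case: bS.2 => D D0 DP.
(* [S y] is a limit of points of the closed [rg k.+1], hence equals [S (iter k S w)]; the lower
   bound for [S] then forces [y = iter k S w]. *)
have [_ [w _ <-] wy] : (S @` rg k) (S y).
  rewrite rgS; move/closed_nrmP: ck; apply => e e0.
  have [|x kx yx] := ycl (e / (D + 1)); first by rewrite divr_gt0 //; lra.
  exists (S x); first by rewrite -rgS; exists x.
  rewrite -(blinB bS); apply: le_lt_trans (DP _) _.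
  move: yx; rewrite ltr_pdivlMr; last lra.
  have := nrm_ge0 (y - x); nra.
suff -> : y = iter k S w by exists w.
apply/eqP; rewrite -subr_eq0; apply/eqP; apply: nrm_small => e e0.
have CD := mulr_ge0 C0 D0.
have [|x kx yx] := ycl (e / (C * D + 1)); first by rewrite divr_gt0 //; lra.
have /CB : rg k (x - iter k S w) by apply: (subspB (lsubspace_rg k)) => //; exists w.
rewrite (blinB bS) wy -(blinB bS) => h.
have h2 : C * nrm (S (x - y)) <= C * (D * nrm (x - y)) by rewrite ler_wpM2l.
have := nrm_triangle x y (iter k S w).
move: yx; rewrite ltr_pdivlMr; last lra.
rewrite (nrmBC y x); have := nrm_ge0 (x - y); nra.
Qed.

Lemma upper_semi_fredholm_closed_rg : upper_semi_fredholm S -> forall m, closed (rg m).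
Proof.
case=> cS /fin_dimP[s ss] m.
have T0 : rg 0 = setT by apply/seteqP; split=> // x _; exists x.
by apply: (@closed_rg_up 0 s) => //; rewrite T0.
Qed.

Lemma upper_semi_browder_left_drazin : upper_semi_browder S -> left_drazin S.
Proof.
case=> uS /finite_ascent_min[p [pE pmin]]; exists p; split=> //; split=> //.
exact: upper_semi_fredholm_closed_rg.
Qed.

Lemma upper_semi_fredholm_ker : upper_semi_fredholm S ->
  forall n, exists t, ker n `<=` lspan t.
Proof.
case=> _ /fin_dimP[s ss]; elim=> [|n [t nt]].
  by exists [::] => x.
have [||t' t'P] := @fin_preimage _ _ S (ker n) t s bS _ nt.
- split; first exact: blin0 (blin_iter bS n).
  move=> a x y xn yn; rewrite /Defs.kernel /= (blin_iter bS n).1 xn yn.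
  by rewrite scaler0 addr0.
- by move=> x Sx; apply: ss.
by exists t' => x xn; apply: t'P; rewrite /Defs.kernel /= -iterSr.
Qed.

(** Writing [iter n S x = S (iter n S y) + z] puts [x - S y] in the preimage of a finite-dimensional
    space under [iter n S], whose kernel is finite-dimensional as well. *)
Lemma b_fredholm_fredholm : upper_semi_fredholm S -> b_fredholm S -> fredholm S.
Proof.
move=> uS [n [cn [_ [s sP]]]]; split=> //.
have [t nt] := upper_semi_fredholm_ker uS n.
have [t' t'P] := fin_preimage (blin_iter bS n) (lsubspace_lspan s) (fun _ h => h) nt.
exists t' => x _.
have [|_ [z [[y _ <-] [/in_spanP zs xE]]]] := sP (iter n S x); first by exists x.
exists y, (x - S y); split=> //; split; last by rewrite addrC subrK.
apply/in_spanP/t'P => /=.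
by rewrite (blinB (blin_iter bS n)) xE -iterSr iterS addrAC subrr add0r.
Qed.

Lemma fredholm_b_fredholm : fredholm S -> b_fredholm S.
Proof.
move=> fS; exists 0%N.
have -> : rg 0 = setT by apply/seteqP; split=> // x _; exists x.
by split => //; exact: closedT.
Qed.

Lemma closed_bounded_below (B : X -> X) (M : set X) (C : R) :
  blin B -> lsubspace M -> closed M -> 0 <= C ->
  (forall x, M x -> nrm x <= C * nrm (B x)) -> closed (B @` M).
Proof.
move=> bB sM cM C0 CP; apply/closed_nrmP => y ycl.
have h0 n : 0 < 2^-1 ^+ n :> R by rewrite exprn_gt0 // invr_gt0.
have /choice[x xP] : forall n, exists x, M x /\ nrm (y - B x) < 2^-1 ^+ n.
  by move=> n; have [_ [x Mx <-] yx] := ycl _ (h0 n); exists x.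
have h2 n m : (n <= m)%N -> 2^-1 ^+ m <= 2^-1 ^+ n :> R.
  by move=> nm; rewrite ler_wiXn2l // ?invr_ge0 //; lra.
have [l xl] : exists l, nrm_cvg x l.
  apply: nrm_complete => e e0.
  have [n nB] := @half_pow_small R (C * 2) e (mulr_ge0 C0 (ler0n _ 2)) e0.
  exists n => m nm; apply: le_lt_trans (nB _ (leqnn n)).
  apply: le_trans (CP _ (subspB sM (xP n).1 (xP m).1)) _.
  rewrite -mulrA ler_wpM2l // (blinB bB).
  have := nrm_triangle y (B (x n)) (B (x m)); rewrite (nrmBC (B (x n)) y).
  have := (xP n).2; have := (xP m).2; have := h2 _ _ nm; lra.
exists l; first exact: nrm_cvg_closed cM (fun n => (xP n).1) xl.
apply: nrm_cvg_unique (blin_cvg bB xl) _ => e e0.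
have [n nB] := @half_pow_small R 1 e ltac:(lra) e0.
exists n => m /nB; rewrite mul1r /= nrmBC; apply: lt_trans; exact: (xP m).2.
Qed.

Lemma small_scalar (e : R) : 0 < e -> exists2 mu : R[i], mu != 0 & normc mu = e.
Proof.
move=> e0; exists (e%:C%C); last by rewrite normcC gtr0_norm.
by rewrite (inj_eq (@complexI R)) gt_eqF.
Qed.

(* S is bounded below on M = rg p, hence so is S - mu for small mu; then S - mu is
   injective with closed range on X. Finite codimension of (S - mu) M in M passes
   to S M by [gap_finite]. *)
Lemma left_drazin_b_fredholm : left_drazin S ->
  (forall mu, upper_semi_browder (sh mu) -> fredholm (sh mu)) -> b_fredholm S.
Proof.
move=> [p [pE [_ cp]]] usbF.
have [cM [C C0 CP]] := closed_rg_down pE cp.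
have sM := lsubspace_rg p.
(* With [normc mu * C] at most [32^-1], the shift keeps a lower bound with constant [2 * C], and the
   gap estimate below stays under one half. *)
have [mu mu0 nmu] := @small_scalar (32 * (C + 1))^-1 ltac:(rewrite invr_gt0; lra).
have mC : normc mu * (C + 1) = 32^-1.
  by rewrite nmu invfM mulfVK // gt_eqF //; lra.
have m0 := normc_ge0 mu.
have bsh := blin_shift bS mu.
have CP' x : rg p x -> nrm x <= 2 * C * nrm (sh mu x).
  move=> /CP h; have := nrmD (sh mu x) (mu *: x); rewrite /Defs.shift subrK nrmZ => h2.
  have x0 := nrm_ge0 x; have : C * nrm (S x) <= C * (nrm (S x - mu *: x) + normc mu * nrm x) by rewrite ler_wpM2l.
  have : C * normc mu <= 32^-1 by nra.
  nra.
have cN : closed (sh mu @` rg p).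
  by apply: (closed_bounded_below bsh sM cM _ CP'); lra.
(* Eigenvectors lie in [rg p], so the bound there gives injectivity on all of [X]. *)
have inj x : sh mu x = 0 -> x = 0.
  move=> x0; have /CP' := kernel_shift_sub p mu0 x0.
  rewrite x0 nrm0 mulr0 => h; apply: nrm_eq0; have := nrm_ge0 x; lra.
have /usbF[_ [s sP]] : upper_semi_browder (sh mu).
  split; last first.
    exists 0%N; apply/seteqP; split=> x /=; last exact: inj.
    by rewrite /Defs.kernel /= => ->; exact: blin0.
  split; first exact: closed_range_shift mu0 cN.
  by apply/fin_dimP; exists [::] => x [_ /inj].
have sN := subspace_image sM bsh.
have subBB (a b c d : X) : a - b - (c - d) = a - c - (b - d).
  by rewrite !opprD addrACA.
have [_ [C2 C20 C2P]] := closed_sumsp (map (iter p S) s) cN sN.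
(* A unit-ball vector [x] is split as [f] plus an element of the image of [rg p] under [sh mu]; the
   images under [iter p S] of the vectors [s] supply [f]. *)
have [||||||s' s'P] := @gap_finite _ _ (rg p) (S @` rg p)
    (fun x f => nrm x <= 1 /\ (sh mu @` rg p) (x - f)) (map (iter p S) s) C2 (8^-1) sM.
- by rewrite rgS.
- exact: subspace_image.
- by rewrite rgS; exact: rg_sub.
- lra.
- move=> x [w _ wx] x1.
  have [|f [fs Nf fC]] := C2P x; last first.
    by exists f; split=> //; apply: le_trans fC _; rewrite ler_piMr.
  have [y [z [_ [/in_spanP zs wE]]]] := sP w I.
  exists (iter p S z); first exact: lspan_image (blin_iter bS p) zs.
  exists (iter p S y); first by exists y.
  by rewrite -wx wE (blinD (blin_iter bS p)) iter_shift addrK.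
- move=> x f x' f' [x1 [m Mm mx]] [x'1 [m' Mm' mx']] ff'.
  exists (S (m - m')); first by exists (m - m') => //; exact: subspB.
  have /CP' := subspB sM Mm Mm'; rewrite (blinB bsh) mx mx' => h.
  have -> : x - x' - S (m - m') = (f - f') - mu *: (m - m').
    have : sh mu (m - m') = x - f - (x' - f') by rewrite (blinB bsh) mx mx'.
    rewrite /Defs.shift => /eqP; rewrite subr_eq => /eqP ->.
    rewrite subBB opprD opprB addrA; congr (_ - _).
    by rewrite addrCA subrr addr0.
  have q : nrm (x - f - (x' - f')) <= nrm x + nrm x' + nrm (f - f').
    by rewrite subBB; apply: le_trans (nrmB _ _) _; have := nrmB x x'; lra.
  apply: le_lt_trans (nrmB _ _) _; rewrite nrmZ.
  have d0 := nrm_ge0 (m - m').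
  have : normc mu * nrm (m - m') <= normc mu * (2 * C * (17 / 8)).
    by rewrite ler_wpM2l //; apply: le_trans h _; rewrite ler_wpM2l //; lra.
  nra.
exists p; split=> //; split.
  split; first by rewrite rgS.
  by apply/fin_dimP; exists [::] => x [xp Sx]; exact: (ker_rg_inj pE (leqnn p)).
exists s' => x /s'P[f fs [y py yE]]; exists y, f; split=> //; split; first exact/in_spanP.
by rewrite yE subrK.
Qed.

(** On [M = rg n], bounded solvability of [y = S x + f] survives a small perturbation by
    [approx_solve]; this gives closed range and finite codimension on [M]. A gap argument bounds the
    kernel, and coprimality of [sh mu] and [iter n S] carries all three over to [X]. *)
Lemma b_fredholm_shift : b_fredholm S -> exists2 e : R, 0 < e &
  forall mu, mu != 0 -> normc mu <= e -> fredholm (sh mu).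
Proof.
move=> [n [cM [[cSM /fin_dimP[t tP]] [s sP]]]].
have sM := lsubspace_rg n.
have [C1 C10 C1P] : exists2 C : R, 0 <= C & forall y, (S @` rg n) y ->
    exists x, [/\ rg n x, S x = y & nrm x <= C * nrm y].
  by rewrite rgS in cSM *; exact: rg_bounded_preimage.
have sSM := subspace_image sM bS.
have [_ [C2 C20 C2P]] := closed_sumsp s cSM sSM.
have sl := lsubspace_lspan s.
(* [C] bounds both parts of a solution of [y = S x + f]: [f] by [C2], and then [x] by
   [C1 * (1 + C2)]. *)
pose C := C1 * (1 + C2) + C2.
have C0 : 0 <= C by rewrite addr_ge0 // mulr_ge0 // addr_ge0.
have C12 : 0 <= C1 * C2 by rewrite mulr_ge0.
exists (8 * (C + 1))^-1 => [|mu mu0]; first by rewrite invr_gt0; lra.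
rewrite -div1r ler_pdivlMr; last lra.
move=> mC; have m0 := normc_ge0 mu.
have bsh := blin_shift bS mu.
have mCC : normc mu * C <= 8^-1 by nra.
have mC1 : normc mu * C1 <= 8^-1 by rewrite /C in mCC; nra.
(* A solution for [S] leaves the residual [mu *: x] for [sh mu], at most an eighth of [nrm y]. *)
have MshD y : rg n y -> exists x f, [/\ rg n x, lspan s f, nrm x <= 2 * C * nrm y,
    nrm f <= 2 * C * nrm y & y = sh mu x + f].
  apply: (approx_solve bsh sM cM sl (@closed_lspan _ _ s) C0) => {}y My.
  have [|f [fs [x0 Mx0 x0E] fC]] := C2P y.
    have [u [z [Mu [/in_spanP zs ->]]]] := sP y My.
    by exists z => //; rewrite addrK; exists u.
  have [|x [Mx xE xC]] := C1P (y - f); first by exists x0.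
  have y0 := nrm_ge0 y.
  have xC' : nrm x <= C1 * (1 + C2) * nrm y.
    apply: le_trans xC _; rewrite -mulrA ler_wpM2l //.
    by apply: le_trans (nrmB _ _) _; lra.
  have fin : y - sh mu x - f = mu *: x.
    by rewrite /Defs.shift xE !opprB addrCA [y + _]addrCA subrr addr0 addrK.
  exists x, f; split=> //.
  - by apply: le_trans xC' _; rewrite ler_wpM2r // lerDl.
  - by apply: le_trans fC _; rewrite ler_wpM2r // lerDr mulr_ge0 // addr_ge0.
  rewrite fin; split; first exact: subspZ.
  rewrite nrmZ.
  have : normc mu * nrm x <= normc mu * (C * nrm y).
    by rewrite ler_wpM2l //; apply: le_trans xC' _; rewrite ler_wpM2r // lerDl.
  nra.
have sN := subspace_image sM bsh.
have cN : closed (sh mu @` rg n).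
  have sQ : lsubspace ((sh mu @` rg n) `&` lspan s).
    split; first by split; [exact: sN.1 | exact: sl.1].
    by move=> a x y [? ?] [? ?]; split; [exact: sN.2 | exact: sl.2].
  have [s' s'E] := lsubspace_fin sQ (@subIsetr _ _ _).
  apply/closed_nrmP => y ycl.
  have My : rg n y.
    move/closed_nrmP: cM; apply => e /ycl[_ [x Mx <-] yx].
    by exists (sh mu x) => //; exact: rg_shift.
  have [x0 [f0 [Mx0 f0s _ _ yE]]] := MshD y My.
  (* Only [f0] remains to be placed in the image: it is a limit of vectors [f0 - f1] in the
     intersection of that image with [lspan s], which is finite-dimensional and so closed. *)
  have [Nf0 _] : ((sh mu @` rg n) `&` lspan s) f0.
    have := @closed_lspan _ _ s'; rewrite -s'E => /closed_nrmP; apply => e e0.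
    have [|_ [x Mx <-] yx] := ycl (e / (2 * C + 1)); first by rewrite divr_gt0 //; lra.
    have My' : rg n (y - sh mu x) by apply: subspB => //; exact: rg_shift.
    have [x1 [f1 [Mx1 f1s _ f1C fE]]] := MshD _ My'.
    exists (f0 - f1); last first.
      rewrite opprB addrCA subrr addr0; apply: le_lt_trans f1C _.
      move: yx; rewrite ltr_pdivlMr; last lra.
      have := nrm_ge0 (y - sh mu x); nra.
    split; last exact: subspB.
    exists (x + x1 - x0); first by apply: subspB => //; exact: subspD.
    rewrite (blinB bsh) (blinD bsh).
    have -> : f0 = y - sh mu x0 by rewrite yE addrAC subrr add0r.
    have -> : f1 = y - sh mu x - sh mu x1 by rewrite fE addrAC subrr add0r.
    move: (sh mu x) (sh mu x1) (sh mu x0) => a b c.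
    by rewrite -[y - a - b]addrA -opprD opprB [RHS]addrC addrA subrK.
  by rewrite yE; apply: subspD => //; exists x0.
split; first split.
- exact: closed_range_shift mu0 cN.
- have sP' : lsubspace (rg n `&` Defs.kernel (sh mu)).
    split; first by split; [exact: sM.1 | exact: blin0].
    move=> a x y [Mx kx] [My ky]; split; first exact: sM.2.
    by rewrite /Defs.kernel /= bsh.1 kx ky scaler0 addr0.
  (* Since [S x = mu *: x], subtracting a small preimage of [S x] moves a unit-ball eigenvector [x]
     into the kernel of [S]; eigenvectors with nearby kernel parts are themselves close. *)
  have [||||s' s'P] := @gap_finite _ _ (rg n `&` Defs.kernel (sh mu)) [set 0]
      (fun x f => nrm (x - f) <= 8^-1) t 2 (8^-1) sP' (@closed_zero _ _) (@lsubspace0 _ _).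
  + by move=> x ->; exact: sP'.1.
  + lra.
  + move=> x [Mx /eqP]; rewrite subr_eq0 => /eqP Sx x1.
    have [|m [Mm mE mB]] := C1P (S x); first by exists x.
    have mB' : nrm m <= 8^-1.
      apply: le_trans mB _; rewrite Sx nrmZ.
      have := nrm_ge0 x; have : 0 <= normc mu * C1 by rewrite mulr_ge0.
      nra.
    exists (x - m); split.
    * by apply: tP; split; [exact: subspB | rewrite /Defs.kernel /= (blinB bS) mE subrr].
    * by apply: le_trans (nrmB _ _) _; lra.
    * by rewrite opprB addrCA subrr addr0.
  + move=> x f x' f' xf xf' ff'; exists 0 => //; rewrite subr0.
    have := nrm_triangle f x x'; have := nrm_triangle f' f x'.
    rewrite (nrmBC f' x'); lra.
  apply/fin_dimP; exists s' => x [_ kx]; rewrite -sumsp0; apply: s'P.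
  by split => //; exact: kernel_shift_sub kx.
- exists s => x _; have [w wE] := shift_coprime n x mu0.
  have [|y [f [_ fs _ _ yE]]] := MshD (mu ^- n *: iter n S x).
    by apply: subspZ => //; exists x.
  exists (w + y), f; split=> //; split; first exact/in_spanP.
  by rewrite (blinD bsh) -wE -addrA -yE subrK.
Qed.

(* If the ascent is infinite, S maps Y = \bigcap_j rg j onto itself with a nonzero
   kernel. Both facts survive a small shift, and an operator that is onto Y but
   not injective on Y has infinite ascent. *)
Lemma b_fredholm_finite_ascent : b_fredholm S ->
  (forall mu, fredholm (sh mu) -> finite_ascent (sh mu)) -> finite_ascent S.
Proof.
move=> bf fasc; have [e e0 eP] := b_fredholm_shift bf.
have [n [cM [[cSM /fin_dimP[t tP]] _]]] := bf.
rewrite rgS in cSM; have cl := closed_rg_up cM cSM tP.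
have sA k : lsubspace (rg (n + k) `&` Defs.kernel S).
  have sr := lsubspace_rg (n + k); have sk := lsubspace_kernel.
  split; first by split; [exact: sr.1 | exact: sk.1].
  by move=> a x y [? ?] [? ?]; split; [exact: sr.2 | exact: sk.2].
have [||k0 k0P] := decreasing_subspaces_stabilize (s := t) sA.
- by move=> k x [xk ?]; split=> //; move: xk; apply: rg_sub; rewrite leq_add2l.
- by rewrite addn0.
set m := (n + k0)%N in k0P.
have mP j : rg (m + j) `&` Defs.kernel S = rg m `&` Defs.kernel S.
  by rewrite /m -addnA k0P // leq_addr.
apply: contrapT => nasc.
(* If [S] were injective on [rg m], the kernels would be stationary from [m] on. *)
have [x0 [mx0 Sx0 x00]] : exists x, [/\ rg m x, S x = 0 & x <> 0].
  apply: contrapT => nx; apply: nasc; exists m.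
  apply/seteqP; split; first exact: ker_sub.
  by move=> x xm; apply: contrapT => Smx; apply: nx; exists (iter m S x); split.
have nm : (n <= m)%N by exact: leq_addr.
have [C C0 CP] := rg_bounded_preimage (cl _ (leqW nm)).
pose Y := \bigcap_j rg (m + j).
have sY : lsubspace Y.
  split; first by move=> j _; exact: (lsubspace_rg _).1.
  by move=> a x y Yx Yy j _; apply: (lsubspace_rg _).2; [exact: Yx | exact: Yy].
have cY : closed Y.
  by apply: closed_bigI => j _; apply: cl; rewrite (leq_trans nm) // leq_addr.
have kerY x : rg m x -> S x = 0 -> Y x.
  by move=> mx Sx j _; have : (rg m `&` Defs.kernel S) x by []; rewrite -(mP j) => -[].
(* Two preimages of [y] in [rg m] differ by a kernel element, which lies in [Y]; hence the small
   preimage [x] is in every [rg (m + j)]. *)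
have Ypre y : Y y -> exists x, [/\ Y x, S x = y & nrm x <= C * nrm y].
  move=> Yy; have [|x [mx xE xC]] := CP y; first by rewrite -addn1; exact: Yy.
  exists x; split=> // j _.
  have [w _ wE] := Yy j.+1 I.
  rewrite -(subrK (iter (m + j) S w) x); apply: (subspD (lsubspace_rg _)); last by exists w.
  apply: kerY (j) I.
    apply: (subspB (lsubspace_rg _)) => //.
    by apply: (@rg_sub m (m + j)); [exact: leq_addr | exists w].
  by rewrite (blinB bS) xE -iterS -addnS wE subrr.
(* The bound [e] makes [sh mu] Fredholm; the other keeps it onto [Y] and the perturbed kernel vector
   nonzero. *)
have [mu mu0 nmu] := @small_scalar (Num.min e (4 * (C + 1))^-1)
  ltac:(rewrite lt_min e0 invr_gt0; lra).
have mue : normc mu <= e by rewrite nmu ge_min lexx.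
have muC : normc mu * C <= 4^-1.
  have : normc mu <= (4 * (C + 1))^-1 by rewrite nmu ge_min lexx orbT.
  rewrite -div1r ler_pdivlMr; last lra.
  have := normc_ge0 mu; nra.
have bsh := blin_shift bS mu.
have Ysh y : Y y -> exists2 x, Y x /\ sh mu x = y & nrm x <= 2 * C * nrm y.
  move=> Yy.
  have [{Yy}y Yy|x [f [Yx -> xC _ yE]]] :=
    approx_solve bsh sY cY (@lsubspace0 _ _) (@closed_zero _ _) C0 _ Yy; last first.
    by exists x => //; split => //; rewrite [in RHS]yE addr0.
  have [x [Yx xE xC]] := Ypre y Yy.
  have fin : y - sh mu x - 0 = mu *: x by rewrite subr0 /Defs.shift xE opprB addrCA subrr addr0.
  exists x, 0; rewrite fin nrm0; split=> //; first by rewrite mulr_ge0 // nrm_ge0.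
  split; first exact: (subspZ sY).
  rewrite nrmZ; have : normc mu * nrm x <= normc mu * (C * nrm y) by rewrite ler_wpM2l // normc_ge0.
  have := nrm_ge0 y; nra.
have Yx0 := kerY _ mx0 Sx0.
have [z [Yz shz z0]] : exists z, [/\ Y z, sh mu z = 0 & z <> 0].
  have [w [Yw wE] wC] := Ysh _ (subspZ sY mu Yx0).
  (* [w] corrects [x0] to an eigenvector for [mu]; its norm is at most half that of [x0], so the sum
     is not zero. *)
  exists (x0 + w); split; first exact: (subspD sY).
    by rewrite (blinD bsh) wE /Defs.shift Sx0 sub0r addNr.
  move=> /eqP; rewrite addr_eq0 => /eqP x0w.
  have := nrm_gt0 x00; move: wC; rewrite nrmZ -(nrmN w) -x0w.
  nra.
have [k kE] := fasc _ (eP _ mu0 mue).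
(* Pulling [z] back [k] times inside [Y] gives a vector killed by the power [k.+1] of the shift but
   not by the power [k]. *)
have [w [Yw wz]] : exists w, Y w /\ iter k (sh mu) w = z.
  elim: (k) => [|j [w [Yw wE]]]; first by exists z.
  by have [v [Yv vw] _] := Ysh _ Yw; exists v; split=> //; rewrite iterSr vw.
have : Defs.kernel (iter k.+1 (sh mu)) w by rewrite /Defs.kernel /= wz.
by rewrite -kE /Defs.kernel /= wz.
Qed.

(** Closedness of [rg p.+1] is reached from [rg n]: upward by [closed_rg_up], or downward by
    [closed_rg_down], which is available at each level from [p] on because the kernels are
    stationary there. *)
Lemma b_fredholm_left_drazin : b_fredholm S ->
  (forall mu, fredholm (sh mu) -> finite_ascent (sh mu)) -> left_drazin S.
Proof.
move=> bf fasc.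
have [p [pE pmin]] := finite_ascent_min (b_fredholm_finite_ascent bf fasc).
exists p; split=> //; split=> //.
have [n [cM [[cSM /fin_dimP[t tP]] _]]] := bf.
rewrite rgS in cSM; have cl := closed_rg_up cM cSM tP.
have [np|pn] := leqP n p.+1; first exact: cl.
have down j : (p.+1 + j <= n)%N -> closed (rg (n - j)).
  elim: j => [|j IH] jn; first by rewrite subn0.
  have := IH ltac:(by apply: leq_trans jn; rewrite leq_add2l).
  have jn1 : (j.+1 <= n)%N := leq_trans (leq_addl _ _) jn.
  have pj : (p <= n - j.+1)%N by rewrite leq_subRL // addnC ltnW.
  have -> : (n - j = (n - j.+1).+1)%N by rewrite subnSK.
  move=> /closed_rg_down h; apply: (h _).1.
  by rewrite !(ker_stable pE) // leqW.
have pn1 := ltnW pn; have := down (n - p.+1)%N; rewrite subnKC // subKn //; exact.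
Qed.

End Operator.

(** * Comparison of the spectra *)

Lemma shift_shift (R : realType) (X : normedModType R[i]) (T : X -> X) l mu :
  Defs.shift (Defs.shift T l) mu = Defs.shift T (l + mu).
Proof. by apply/funext => x; rewrite /Defs.shift scalerDl opprD addrA. Qed.

Theorem theorem2p14 (R : realType) (X : completeNormedModType R[i])
    (T : {linear X -> X}) :
  continuous T -> ~ fin_dim [set: X] ->
  (ess_spec T `<=` usb_spec T <-> bf_spec T `<=` ld_spec T) /\
  (usb_spec T = ess_spec T <-> ld_spec T = bf_spec T).
Proof.
move=> /blin_continuous_linear bT _.
have bs l := blin_shift bT l.
have contra (A B : set R[i]) : (forall l, ~ A l -> ~ B l) -> B `<=` A.
  by move=> h l Bl; apply: contrapT => /h.
have half : ess_spec T `<=` usb_spec T <-> bf_spec T `<=` ld_spec T.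
  split=> sub; apply: contra => l /contrapT hl; apply.
    apply: left_drazin_b_fredholm hl _ => // mu; rewrite shift_shift => hu.
    by apply: contrapT => /sub.
  apply: b_fredholm_fredholm => //; first exact: hl.1.
  by apply: contrapT => /sub; apply; exact: upper_semi_browder_left_drazin.
(* One inclusion of each equality is [half]; the other one rests on recovering finite ascent. *)
split=> //; split=> E; apply/seteqP; split.
- apply: contra => l /contrapT hl; apply.
  apply: b_fredholm_left_drazin hl _ => // mu; rewrite shift_shift => hf.
  suff : ~ usb_spec T (l + mu) by move=> /contrapT[].
  by rewrite E; apply.
- by apply/half; rewrite E.
(* A Fredholm operator is B-Fredholm, so the equality makes it left Drazin invertible, which
   supplies the finite ascent. *)
- apply: contra => l /contrapT hl; apply; split; first exact: hl.1.
  have : ~ ld_spec T l by rewrite E; apply; exact: fredholm_b_fredholm.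
  by move=> /contrapT[p [pE _]]; exists p.
- by apply/half; rewrite E.
Qed.
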